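(* Let $\mathcal{V}$ be a finite vocabulary with $|\mathcal{V}|\ge 2$, let $l\in\mathbb{R}^{|\mathcal{V}|}$ be a logits vector, and let $p=\mathrm{softmax}(l)$, i.e. $p[i]=e^{l[i]}/\sum_{j\in\mathcal{V}}e^{l[j]}$. Let $\xi=(\xi[i])_{i\in\mathcal{V}}$ have i.i.d. $\mathrm{Gumbel}(0,1)$ coordinates (CDF $F(x)=e^{-e^{-x}}$), and define the per-token score of a token $w\in\mathcal{V}$ as $s=\xi[w]$. (1) (Watermarked token.) Let $w^\ast=\operatorname{argmax}_{i\in\mathcal{V}}\,(l[i]+\xi[i])$ (the Logits-Addition watermarked token). Then for every $w\in\mathcal{V}$, conditionally on the event $\{w^\ast=w\}$, the score $s=\xi[w]$ satisfies $$\mathbb{E}[s\mid w^\ast=w]=-\log p[w]+\gamma,\qquad \mathrm{Var}[s\mid w^\ast=w]\le \frac{2\,p[w]^2}{(1-p[w])^3}+\frac{2}{p[w]}-\bigl(-\log p[w]+\gamma\bigr)^2 .$$ (2) (Unwatermarked token.) If $w$ is a token (fixed or random) chosen independently of $\xi$, then the score $s=\xi[w]$ satisfies $$\mathbb{E}[s]=\gamma,\qquad \mathrm{Var}[s]=\frac{\pi^2}{6}.$$ Here $\gamma$ denotes the Euler–Mascheroni constant.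
   Context: This describes one decoding step of the Logits-Addition watermark: at position $t$ a language model gives a logits vector $l=l_t$ for the next token, a watermark key $\xi=\xi_t$ (a vector of independent standard Gumbel random variables indexed by the vocabulary) is drawn, the next token is generated as $w_t=\operatorname{argmax}_i(l_t[i]+\xi_t[i])$, and the detector assigns the per-token score $s_t=\xi_t[w_t]$. For unwatermarked (e.g. human-written) text, the token $w_t$ has no dependence on the key $\xi_t$. The standard Gumbel$(0,1)$ distribution has density $e^{-(x+e^{-x})}$ on $\mathbb{R}$. *)

(* Defs.v *)
From HB Require Import structures.
From mathcomp Require Import all_boot all_order all_algebra.
From mathcomp Require Import all_classical all_reals all_analysis.
Set Implicit Arguments. Unset Strict Implicit. Unset Printing Implicit Defensive.
Import Order.TTheory GRing.Theory Num.Theory.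
Import numFieldNormedType.Exports.
Local Open Scope classical_set_scope.
Local Open Scope ring_scope.

Definition euler_gamma (R : realType) : R :=
  limn (fun n : nat => \sum_(1 <= k < n.+1) (k%:R : R)^-1 - ln (n%:R : R)).

Definition softmax (R : realType) (V : finType) (l : V -> R) (w : V) : R :=
  expR (l w) / \sum_(j : V) expR (l j).

Definition is_gumbel01 d (T : measurableType d) (R : realType)
  (P : probability T R) (X : T -> R) : Prop :=
  forall x : R, P [set t | X t <= x] = (expR (- expR (- x)))%:E.

Definition mutually_independent d (T : measurableType d) (R : realType)
  (P : probability T R) (I : finType) (X : I -> T -> R) : Prop :=
  forall B : I -> set R, (forall i, measurable (B i)) ->
    P (\bigcap_(i in [set: I]) (X i @^-1` B i)) =
    (\prod_(i : I) P (X i @^-1` B i))%E.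

Definition token_independent d (T : measurableType d) (R : realType)
  (P : probability T R) (V : finType) (W : T -> V) (I : finType)
  (X : I -> T -> R) : Prop :=
  forall (j : V) (B : I -> set R), (forall i, measurable (B i)) ->
    P ([set t | W t = j] `&` \bigcap_(i in [set: I]) (X i @^-1` B i)) =
    (P [set t | W t = j] * P (\bigcap_(i in [set: I]) (X i @^-1` B i)))%E.

Definition cond_expectation d (T : measurableType d) (R : realType)
  (P : probability T R) (A : set T) (X : T -> R) : \bar R :=
  ((\int[P]_(t in A) (X t)%:E) * ((fine (P A))^-1)%:E)%E.

Definition cond_variance d (T : measurableType d) (R : realType)
  (P : probability T R) (A : set T) (X : T -> R) : \bar R :=
  cond_expectation P A (fun t => (X t - fine (cond_expectation P A X)) ^+ 2).

(* Main.v *)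
(** A Gumbel vector conditioned on its perturbed argmax being [w] leaves
    [xi w + ln p] standard Gumbel: on a short interval (a, b], the event
    {argmax = w, xi w in (a, b]} is squeezed between two product events, so its
    probability has density [exp (- x - exp (- x) / p)]. Hence the conditional
    mean is [gamma - ln p] and the conditional variance is exactly [pi^2 / 6],
    which is below the stated bound because [2 e^m >= 2 + 2 m + m^2 + m^3 / 3]
    for [m = - ln p].

    For the moments of a Gumbel variable [X], the variable
    [- ln (1 - F(X)^(1/n))], with [F] the cdf of [X], has the law of the maximum
    of [n] independent exponential variables, whose mean is [H_n] and whose
    variance is [sum_(k <= n) 1 / k^2]; minus [ln n], it converges to [X], so
    that dominated convergence gives the mean [gamma] and the variance
    [sum 1 / k^2]. The latter is [pi^2 / 6] by the doubling formula for
    [1 / sin^2]. Expectations are computed without Lebesgue densities: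
    [E (g(X); a < X <= b)] is an increment of any primitive of [g F'], since
    both have the same derivative. *)
Require Import Defs.
From HB Require Import structures.
From mathcomp Require Import all_boot all_order all_algebra.
From mathcomp Require Import all_classical all_reals all_analysis.
From mathcomp Require Import measurable_realfun.
From mathcomp Require Import ring lra zify.
Import Order.TTheory GRing.Theory Num.Theory.
Import numFieldNormedType.Exports.
Local Open Scope classical_set_scope.
Local Open Scope ring_scope.

(** * Primitives from increments *)

Section increments.
Context {R : realType}.
Implicit Types (F K g f Phi : R -> R) (I : R -> R -> R).

(** Near [x], [g] stays within any eps of [g x], so an increment of [K] is [g x] times that of [F],
    up to eps times the latter. This is dK = g dF at the level of difference quotients. *)
Lemma is_derive_increments F K g (f x : R) : {homo F : a b / a <= b} ->
  is_derive x 1 F f -> {for x, continuous g} -> (forall y, 0 <= g y) ->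
  (forall a b m M, a <= b -> 0 <= m ->
    (forall y, a <= y <= b -> m <= g y <= M) ->
    m * (F b - F a) <= K b - K a <= M * (F b - F a)) ->
  is_derive x 1 K (g x * f).
Proof.
move=> F_nd [dF Ff] cg g0 H.
have KF eps : 0 < eps -> \forall y \near x,
    `|K y - K x - g x * (F y - F x)| <= eps * `|F y - F x|.
  move=> e0; have /cvgrPdist_le/(_ _ e0)[d /= d0 dP] := cg.
  near=> y.
  have xyd : `|x - y| < d by near: y; exists d.
  (* The lower bound is truncated at 0 because the increment hypothesis asks for [0 <= m]. *)
  have gb z : Num.min x y <= z <= Num.max x y ->
      Num.max 0 (g x - eps) <= g z <= g x + eps.
    move=> xzy; have {}/dP : `|x - z| < d.
      apply: le_lt_trans xyd; move: xzy; rewrite ler_norml ge_min le_max.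
      by case: (lerP x y) => xy; rewrite ?(ger0_norm,ler0_norm) ?subr_ge0; lra.
    rewrite ge_max g0/= ler_norml; lra.
  have m0 : 0 <= Num.max 0 (g x - eps) by rewrite le_max lexx.
  have mg : g x - eps <= Num.max 0 (g x - eps) by rewrite le_max lexx orbT.
  have [xy|/ltW yx] := lerP x y.
  - have := F_nd _ _ xy; rewrite -subr_ge0 => F0.
    rewrite (ger0_norm F0).
    have /andP[H1 H2] := H x y _ _ xy m0 (fun z h => gb z ltac:(by rewrite (min_idPl xy) (max_idPr xy))).
    have := ler_wpM2r F0 mg; rewrite ler_norml; lra.
  - have := F_nd _ _ yx; rewrite -subr_ge0 => F0.
    rewrite (distrC (F y)) (ger0_norm F0).
    have /andP[H1 H2] := H y x _ _ yx m0 (fun z h => gb z ltac:(by rewrite (min_idPr yx) (max_idPl yx))).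
    have := ler_wpM2r F0 mg; rewrite ler_norml; lra.
have dFf : h^-1 *: (F (h *: 1 + x) - F x) @[h --> 0^'] --> f.
  by rewrite -Ff; exact: dF.
suff dK : h^-1 *: (K (h *: 1 + x) - K x) @[h --> 0^'] --> g x * f.
  by apply: DeriveDef; [exact: cvgP dK|exact: cvg_lim dK].
rewrite -[X in _ --> X]addr0.
have -> : (fun h => h^-1 *: (K (h *: 1 + x) - K x)) =
  (fun h => g x * (h^-1 *: (F (h *: 1 + x) - F x)) +
   h^-1 *: (K (h *: 1 + x) - K x - g x * (F (h *: 1 + x) - F x))).
  apply/funext => h; rewrite /GRing.scale /=; ring.
apply: cvgD; first exact: cvgMr dFf.
apply/cvgr0Pnorm_le => e e0.
(* Near [x] the difference quotient of [F] is at most [|f| + 1] in absolute value, so this tolerance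
   leaves an error of at most [e]. *)
pose d := e / (`|f| + 1).
have f1 : 0 < `|f| + 1 by rewrite ltr_wpDl.
have d0 : 0 < d by rewrite divr_gt0.
have := KF _ d0.
have shx : (h *: 1 + x : R) @[h --> 0^'] --> x.
  have -> : nbhs x = nbhs ((0 : R) *: 1 + x) by rewrite scale0r add0r.
  apply: cvgD; last exact: cvg_cst.
  apply: cvgZr_tmp; exact: nbhs_dnbhs.
move/shx => K1.
have := dFf => /cvgr_norm_le => /(_ (`|f| + 1)); rewrite ltrDl ltr01 => /(_ isT) F1.
near=> h.
rewrite normrZ.
have H1 : `|K (h *: 1 + x) - K x - g x * (F (h *: 1 + x) - F x)|
   <= d * `|F (h *: 1 + x) - F x| by near: h; exact: K1.
have H2 : `|h^-1 *: (F (h *: 1 + x) - F x)| <= `|f| + 1 by near: h; exact: F1.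
apply: (le_trans (ler_wpM2l (normr_ge0 _) H1)).
rewrite mulrCA -normrZ.
apply: (le_trans (ler_wpM2l (ltW d0) H2)).
by rewrite divfK ?gt_eqF.
Unshelve. all: by end_near. Qed.

Lemma is_derive_continuous (h : R -> R) (x a : R) :
  is_derive x 1 h a -> {for x, continuous h}.
Proof. by move=> [dh _]; apply/differentiable_continuous/derivable1_diffP. Qed.

(** Basing [I] at 0, with a sign on the left as for an oriented integral, gives a function [K] whose
    increments are [I]. It has the same derivative as [Phi], so the two differ by a constant. *)
Lemma increments_primitive F f g I Phi : {homo F : a b / a <= b} ->
  (forall x : R, is_derive x 1 F (f x)) -> continuous g -> (forall x, 0 <= g x) ->
  (forall a b c, a <= b -> b <= c -> I a c = I a b + I b c) ->
  (forall a b m M, a <= b -> 0 <= m ->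
    (forall y, a <= y <= b -> m <= g y <= M) ->
    m * (F b - F a) <= I a b <= M * (F b - F a)) ->
  (forall x : R, is_derive x 1 Phi (g x * f x)) ->
  forall a b, a <= b -> I a b = Phi b - Phi a.
Proof.
move=> F_nd dF cg g0 Iadd Ib dPhi.
pose K x := if 0 <= x then I 0 x else - I x 0.
have KI a b : a <= b -> K b - K a = I a b.
  move=> ab; rewrite /K; have [a0|/ltW a0] := leP 0 a.
    by rewrite (le_trans a0 ab) (Iadd 0 a b)//; ring.
  have [b0|/ltW b0] := leP 0 b; first by rewrite (Iadd a 0 b)//; ring.
  by rewrite (Iadd a b 0)//; ring.
have dK (x : R) : is_derive x 1 K (g x * f x).
  apply: (is_derive_increments _ _ _ _ _ F_nd (dF x) (cg x) g0) => a b m M ab.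
  by rewrite KI//; exact: Ib.
move=> a b ab; rewrite -KI//.
suff e : K a - Phi a = K b - Phi b by lra.
apply: (@is_derive_0_is_cst _ (K - Phi)) => x.
by rewrite -(subrr (g x * f x)); exact: is_deriveB.
Qed.

End increments.

(** * Expectations from the cdf *)

Section law.
Context d (T : measurableType d) (R : realType) (mu : {measure set T -> \bar R}).
Variables (D : set T) (X : T -> R) (F : R -> R).
Hypotheses (mD : measurable D) (mX : measurable_fun setT X).
Hypothesis XF : forall x, mu (D `&` [set t | X t <= x]) = (F x)%:E.

Let slab (a b : R) := D `&` X @^-1` `]a, b].

Let mslab a b : measurable (slab a b).
Proof. by apply: measurableI => //; rewrite -[_ @^-1` _]setTI; exact: mX. Qed.

Let mle a : measurable (D `&` [set t | X t <= a]).
Proof.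
apply: measurableI => //; rewrite (_ : [set _ | _] = X @^-1` `]-oo, a]).
  by rewrite -[_ @^-1` _]setTI; exact: mX.
by apply/seteqP; split=> t; rewrite /= in_itv.
Qed.

Lemma cdf_homo : {homo F : a b / a <= b}.
Proof.
move=> a b ab; rewrite -lee_fin -!XF; apply: le_measure; rewrite ?inE//.
by move=> t [Dt /= ta]; split => //=; exact: le_trans ab.
Qed.

Lemma measure_slab a b : a <= b -> mu (slab a b) = (F b - F a)%:E.
Proof.
move=> ab; pose L x := D `&` [set t | X t <= x].
rewrite (_ : slab a b = L b `\` L a).
  have fb : (mu (L b) < +oo)%E by rewrite XF ltry.
  have -> : mu (L b `\` L a) = (mu (L b) - mu (L b `&` L a))%E.
    exact: measureD (mle b) (mle a) fb.
  rewrite (_ : L b `&` L a = L a) ?XF ?EFinB//.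
  apply/seteqP; split=> t /=; first by case.
  by move=> [Dt ta]; do 2?split => //; exact: le_trans ab.
apply/seteqP; split=> t; rewrite /slab/L/= in_itv/=.
  move=> [Dt /andP[aX ->]]; split => // -[_]; by rewrite leNgt aX.
move=> [[Dt ->] h]; split => //; rewrite andbT ltNge; apply/negP => h'; exact: h.
Qed.

Lemma slab_bigcup : \bigcup_n slab (- n%:R) n%:R = D.
Proof.
apply/seteqP; split=> t; first by move=> [n _ []].
move=> Dt; exists (Num.Def.truncn `|X t|).+1 => //; split => //=.
rewrite in_itv/=; have := truncnS_gt `|X t|; rewrite ltr_norml => /andP[-> /ltW ->//].
Qed.

Lemma slab_nondecreasing : nondecreasing_seq (fun n => slab (- n%:R) n%:R).
Proof.
move=> m n mn; apply/subsetPset => t [Dt]; rewrite /= in_itv/= => /andP[h1 h2].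
split => //=; rewrite in_itv/=; have : m%:R <= n%:R :> R by rewrite ler_nat.
by move=> ?; apply/andP; split; lra.
Qed.

Variables (f g Phi : R -> R) (c0 c : R).
Hypotheses (dF : forall x : R, is_derive x 1 F (f x))
  (cg : continuous g) (g0 : forall x, 0 <= g x)
  (dPhi : forall x : R, is_derive x 1 Phi (g x * f x)).

Let mgX E : measurable E -> measurable_fun E (EFin \o (g \o X)).
Proof.
move=> mE; apply/measurable_EFinP; apply: measurableT_comp.
  exact: continuous_measurable_fun.
exact: measurable_funTS.
Qed.

Let slab_bounds a b m M : a <= b -> 0 <= m ->
  (forall y, a <= y <= b -> m <= g y <= M) ->
  ((m * (F b - F a))%:E <= \int[mu]_(t in slab a b) (g (X t))%:E <= (M * (F b - F a))%:E)%E.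
Proof.
move=> ab m0 mM; have mS := mslab a b; have M0 : 0 <= M.
  by have /andP[h1 h2] := mM a ltac:(by rewrite lexx ab); exact: le_trans (le_trans m0 h1) h2.
rewrite !EFinM -measure_slab// -!integral_cst//; apply/andP; split.
- apply: ge0_le_integral => //.
  + exact: mgX.
  + move=> t [_ /=]; rewrite in_itv/= lee_fin => /andP[/ltW h1 h2].
    by have /andP[] := mM (X t) ltac:(by rewrite h1 h2).
- apply: ge0_le_integral => //.
  + by move=> t _; rewrite lee_fin.
  + exact: mgX.
  + move=> t [_ /=]; rewrite in_itv/= lee_fin => /andP[/ltW h1 h2].
    by have /andP[] := mM (X t) ltac:(by rewrite h1 h2).
Qed.

Let slab_fin a b : a <= b -> (\int[mu]_(t in slab a b) (g (X t))%:E)%E \is a fin_num.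
Proof.
move=> ab; have [|y _ yP] := @EVT_max _ g a b ab.
  exact: continuous_subspaceT.
have [] := andP (@slab_bounds a b 0 (g y) ab (lexx _) _).
  by move=> z zab; rewrite g0 yP// in_itv.
move=> h1 h2; rewrite ge0_fin_numE; first exact: le_lt_trans h2 (ltry _).
by apply: integral_ge0 => t _; rewrite lee_fin.
Qed.

(** This is [increments_primitive] for the integral over a slab, which is additive because adjacent
    half-open slabs are disjoint. *)
Lemma integral_slab a b : a <= b ->
  (\int[mu]_(t in slab a b) (g (X t))%:E = (Phi b - Phi a)%:E)%E.
Proof.
move=> ab; rewrite -(fineK (slab_fin _ _ ab)); congr EFin.
apply: (@increments_primitive _ F f g
  (fun a b => fine (\int[mu]_(t in slab a b) (g (X t))%:E)%E)) => //.
- exact: cdf_homo.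
- move=> {ab}a {}b e ab be.
  rewrite -fineD ?slab_fin//; congr fine.
  rewrite -ge0_integral_setU//.
  + congr (integral _ _ _); apply/seteqP; split=> t; rewrite /slab/= !in_itv/=.
      move=> [Dt /andP[h1 h2]]; have [h3|h3] := leP (X t) b; [left|right]; by rewrite ?h1 ?h2.
    by move=> [] [Dt /andP[h1 h2]]; split => //; apply/andP; split; lra.
  + exact/mgX/measurableU.
  + by move=> t _; rewrite lee_fin.
  + apply/disj_setPS => t [[_]] /=; rewrite in_itv/= => /andP[_ h1] [_] /=.
    by rewrite in_itv/= => /andP[h2 _]; lra.
- move=> {ab}a {}b m M ab m0 mM.
  have := slab_bounds _ _ _ _ ab m0 mM.
  by rewrite -(fineK (slab_fin _ _ ab)) !lee_fin.
Qed.

(** Monotone convergence along the slabs from [- n] to [n], which exhaust [D]. *)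
Lemma integral_law : Phi n%:R @[n --> \oo] --> c ->
  Phi (- n%:R) @[n --> \oo] --> c0 ->
  (\int[mu]_(t in D) (g (X t))%:E = (c - c0)%:E)%E.
Proof.
move=> Phic Phic0; rewrite -{1}slab_bigcup.
have lim_Phi : (Phi n%:R - Phi (- n%:R))%:E @[n --> \oo] --> (c - c0)%:E.
  by apply: cvg_EFin; [exact: nearW|exact: cvgB].
apply: (cvg_unique _ _ lim_Phi) => //.
have -> : (fun n : nat => (Phi n%:R - Phi (- n%:R))%:E) =
    (fun n => \int[mu]_(t in slab (- n%:R) n%:R) (g (X t))%:E)%E.
  apply/funext => n; rewrite integral_slab//.
  by rewrite (le_trans _ (ler0n _ n))// oppr_le0.
apply: ge0_nondecreasing_set_cvg_integral => //.
- exact: slab_nondecreasing.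
- by move=> n; exact/mgX/mslab.
- by move=> n t _; rewrite lee_fin.
Qed.
End law.

(** * Moments of maxima of exponential variables *)

Section derive_fun.
Context {R : realType}.
Implicit Types (f g : R -> R) (x a b : R).

Lemma is_derive_fD {f g x a b} : is_derive x 1 f a -> is_derive x 1 g b ->
  is_derive x 1 (fun y => f y + g y) (a + b).
Proof. exact: is_deriveD. Qed.

Lemma is_derive_fB {f g x a b} : is_derive x 1 f a -> is_derive x 1 g b ->
  is_derive x 1 (fun y => f y - g y) (a - b).
Proof. exact: is_deriveB. Qed.

Lemma is_derive_fN {f x a} : is_derive x 1 f a ->
  is_derive x 1 (fun y => - f y) (- a).
Proof. exact: is_deriveN. Qed.

Lemma is_derive_fM {f g x a b} : is_derive x 1 f a -> is_derive x 1 g b ->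
  is_derive x 1 (fun y => f y * g y) (f x * b + g x * a).
Proof. exact: is_deriveM. Qed.

Lemma is_derive_fX {f x a} n : is_derive x 1 f a ->
  is_derive x 1 (fun y => f y ^+ n) (n%:R * f x ^+ n.-1 * a).
Proof.
move=> df; rewrite (_ : (fun y => f y ^+ n) = f ^+ n); first exact: is_deriveX.
by rewrite exprfctE.
Qed.

Lemma is_derive_fcomp {f} g {x a b} : is_derive (g x) 1 f a -> is_derive x 1 g b ->
  is_derive x 1 (fun y => f (g y)) (a * b).
Proof. exact: is_derive1_comp. Qed.

Lemma is_derive_fcst (c : R) x : is_derive x 1 (fun=> c) 0.
Proof. exact: is_derive_cst. Qed.

Lemma is_derive_fid x : is_derive x 1 (fun y : R => y) 1.
Proof. exact: is_derive_id. Qed.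

End derive_fun.

Section psi.
Context {R : realType}.
Implicit Types (v x : R) (n N : nat).

(** Truncation of the series of - ln (1 - v); its value at 1 is the harmonic number H_N. *)
Definition harmonic_poly N v : R := \sum_(k < N) v ^+ k.+1 / k.+1%:R.

(* Primitives in [v] of [y d(v^N)] and [y^2 d(v^N)] for [y = - ln (1 - v)]: here
   [v^N] is the cdf at [y] of the maximum of [N] exponential variables. *)
Definition psi1 N v : R := ln (1 - v) * (1 - v ^+ N) + harmonic_poly N v.
Definition psi2 N v : R :=
  - (ln (1 - v) ^+ 2 * (1 - v ^+ N)) + \sum_(k < N) 2 / k.+1%:R * psi1 k.+1 v.

Lemma is_derive_harmonic_poly N v : v < 1 ->
  is_derive v 1 (harmonic_poly N) ((1 - v ^+ N) / (1 - v)).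
Proof.
move=> v1; have v1' : 1 - v != 0 by lra.
elim: N => [|N IH].
  rewrite /harmonic_poly expr0 subrr mul0r.
  under [X in is_derive _ _ X]eq_fun do rewrite big_ord0.
  exact: is_derive_fcst.
rewrite /harmonic_poly; under [X in is_derive _ _ X]eq_fun do rewrite big_ord_recr/=.
apply: is_derive_eq.
  exact: (is_derive_fD IH (is_derive_fM (is_derive_fX N.+1 (is_derive_fid v)) (is_derive_fcst N.+1%:R^-1 v))).
rewrite /= mulr0 add0r mulr1 mulrA mulVf ?pnatr_eq0// mul1r exprS.
by field.
Qed.

Lemma is_derive_ln1B v : v < 1 -> is_derive v 1 (fun v => ln (1 - v)) (- (1 - v)^-1).
Proof.
move=> v1; have v1' : 0 < 1 - v by lra.
have d1B : is_derive v 1 (fun v => 1 - v) (0 - 1).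
  exact: (is_derive_fB (is_derive_fcst 1 v) (is_derive_fid v)).
have := is_derive_fcomp (fun v => 1 - v) (is_derive1_ln v1') d1B.
by rewrite sub0r mulrN1.
Qed.

Lemma is_derive_psi1 N v : v < 1 ->
  is_derive v 1 (psi1 N) (- ln (1 - v) * (N%:R * v ^+ N.-1)).
Proof.
move=> v1; have v1' : 1 - v != 0 by lra.
apply: is_derive_eq.
  exact: (is_derive_fD (is_derive_fM (is_derive_ln1B _ v1)
    (is_derive_fB (is_derive_fcst 1 v) (is_derive_fX N (is_derive_fid v))))
    (is_derive_harmonic_poly N _ v1)).
by rewrite /=; field.
Qed.

Lemma is_derive_psi2 N v : v < 1 ->
  is_derive v 1 (psi2 N) (ln (1 - v) ^+ 2 * (N%:R * v ^+ N.-1)).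
Proof.
move=> v1; have v1' : 1 - v != 0 by lra.
(* Each summand has derivative - 2 ln (1 - v) v^k; their geometric sum cancels the term that comes
   from differentiating the squared logarithm. *)
have dS : is_derive v 1 (fun v => \sum_(k < N) 2 / k.+1%:R * psi1 k.+1 v)
    (- (2 * ln (1 - v)) * ((1 - v ^+ N) / (1 - v))).
  elim: N => [|N IH].
    rewrite expr0 subrr mul0r mulr0.
    under [X in is_derive _ _ X]eq_fun do rewrite big_ord0.
    exact: is_derive_fcst.
  under [X in is_derive _ _ X]eq_fun do rewrite big_ord_recr/=.
  apply: is_derive_eq.
    exact: (is_derive_fD IH (is_derive_fM (is_derive_fcst (2 / N.+1%:R) v)
      (is_derive_psi1 N.+1 _ v1))).
  have N0 : N.+1%:R != 0 :> R by rewrite pnatr_eq0.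
  rewrite /= exprS; field.
  by rewrite v1' nat1r.
apply: is_derive_eq.
  exact: (is_derive_fD (is_derive_fN (is_derive_fM
    (is_derive_fX 2 (is_derive_ln1B _ v1))
    (is_derive_fB (is_derive_fcst 1 v) (is_derive_fX N (is_derive_fid v))))) dS).
by rewrite /=; field.
Qed.

(** With s = w^(1/4), the left side is 16 s^2 (s ln s)^2, and - ln s <= 1 / s bounds the last square
    by 1. The bound tends to 0 with [w]. *)
Lemma mul_ln2_le (w : R) : 0 < w < 1 -> w * ln w ^+ 2 <= 16 * Num.sqrt w.
Proof.
move=> /andP[w0 w1]; pose s := Num.sqrt (Num.sqrt w).
have s0 : 0 < s by rewrite !sqrtr_gt0.
have s1 : s < 1.
  by rewrite -[ltRHS]sqrtr1 ltr_sqrt// -[ltRHS]sqrtr1 ltr_sqrt.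
have sw : Num.sqrt w = s ^+ 2 by rewrite sqr_sqrtr// sqrtr_ge0.
have ws : w = s ^+ 4 by rewrite -[LHS]sqr_sqrtr ?ltW// sw -exprM.
rewrite sw ws lnXn//.
have lns : - ln s <= s^-1.
  by rewrite -lnV//; apply/ltW/ln_sublinear; rewrite invr_gt0.
have h0 : 0 <= - ln s * s.
  by rewrite mulr_ge0 ?(ltW s0)// oppr_ge0 ltW// ln_lt0// s0.
have h1 : - ln s * s <= 1.
  by apply: le_trans (ler_wpM2r (ltW s0) lns) _; rewrite mulVf ?lt0r_neq0.
have h2 : (- ln s * s) ^+ 2 <= 1 by rewrite expr_le1.
have -> : s ^+ 4 * (ln s *+ 4) ^+ 2 = 16 * (s ^+ 2 * (- ln s * s) ^+ 2) by ring.
by rewrite ler_wpM2l// ler_piMr// sqr_ge0.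
Qed.

Lemma onemX_le (v : R) N : 0 <= v <= 1 -> 0 <= 1 - v ^+ N <= N%:R * (1 - v).
Proof.
move=> /andP[v0 v1]; elim: N => [|N /andP[IH1 IH2]]; first by rewrite expr0 subrr mul0r lexx.
have := exprn_ge0 N v0.
have : v ^+ N <= 1 by rewrite exprn_ile1.
rewrite exprS -natr1 => h1 h2.
by apply/andP; split; nra.
Qed.

Section limits.
Variable v : nat -> R.

Lemma cvg_psi0 N : v n @[n --> \oo] --> 0 ->
  psi1 N (v n) @[n --> \oo] --> 0 /\ psi2 N (v n) @[n --> \oo] --> 0.
Proof.
move=> v0.
have h0 M : harmonic_poly M 0 = 0.
  by rewrite /harmonic_poly big1// => i _; rewrite exprS !mul0r.
have p1 M : psi1 M 0 = 0 by rewrite /psi1 h0 subr0 ln1 mul0r add0r.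
have p2 : psi2 N 0 = 0.
  rewrite /psi2 subr0 ln1 expr0n mul0r oppr0 add0r big1// => i _.
  by rewrite p1 mulr0.
split.
- rewrite -(p1 N); apply: cvg_comp v0 _.
  exact: (is_derive_continuous _ _ _ (is_derive_psi1 N _ ltr01)).
- rewrite -p2; apply: cvg_comp v0 _.
  exact: (is_derive_continuous _ _ _ (is_derive_psi2 N _ ltr01)).
Qed.

Hypothesis v01 : forall n, 0 <= v n < 1.
Hypothesis v1 : v n @[n --> \oo] --> (1 : R).

Let cvg_exp1 N : v n ^+ N @[n --> \oo] --> (1 : R).
Proof.
rewrite -[X in _ --> X](expr1n R N).
by apply: (cvg_comp v (fun x : R => x ^+ N) v1); exact: exprn_continuous.
Qed.

Let cvg_onemX N : 1 - v n ^+ N @[n --> \oo] --> (0 : R).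
Proof. by rewrite -(subrr (1 : R)); apply: cvgB => //; exact: cvg_cst. Qed.

(** Bernoulli's inequality bounds 1 - v^N by N (1 - v), and w (ln w)^2 tends to 0 for w = 1 - v. *)
Let cvg_ln2 N : ln (1 - v n) ^+ 2 * (1 - v n ^+ N) @[n --> \oo] --> (0 : R).
Proof.
have c : N%:R * (16 * Num.sqrt (1 - v n)) @[n --> \oo] --> (0 : R).
  rewrite [X in _ --> X](_ : 0 = N%:R * (16 * Num.sqrt 0)); last by rewrite sqrtr0 !mulr0.
  apply: cvgMr; apply: cvgMr.
  apply: cvg_comp; last exact: sqrt_continuous.
  by have := cvg_onemX 1; under eq_fun do rewrite expr1.
apply: (squeeze_cvgr _ (cvg_cst 0) c); apply: nearW => n.
have /andP[v0 vn1] := v01 n.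
have /(onemX_le _ N) /andP[h1 h2] : 0 <= v n <= 1 by rewrite v0 ltW.
rewrite mulr_ge0 ?sqr_ge0//=.
(* [mul_ln2_le] asks for an argument below 1, so the value 0 of [v n] is treated apart. *)
have [->|vn0] := eqVneq (v n) 0.
  by rewrite subr0 ln1 expr0n mul0r !mulr_ge0.
have vn : 0 < v n by rewrite lt_def vn0.
apply: le_trans (ler_wpM2l (sqr_ge0 _) h2) _.
rewrite mulrCA ler_wpM2l// mulrC mul_ln2_le//; lra.
Qed.

(** Reduces to the squared logarithm through |z| <= 1 + z^2. *)
Let cvg_ln N : ln (1 - v n) * (1 - v n ^+ N) @[n --> \oo] --> (0 : R).
Proof.
apply/cvgr0Pnorm_lt => e e0.
have : (1 - v n ^+ N) + ln (1 - v n) ^+ 2 * (1 - v n ^+ N) @[n --> \oo] --> (0 : R).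
  by rewrite -[X in _ --> X]addr0; exact: cvgD.
move=> h; apply: (filterS _ (cvgr0_norm_lt _ h _ e0)) => n.
apply: le_lt_trans.
have /andP[v0 vn1] := v01 n.
have /(onemX_le _ N) /andP[h1 h2] : 0 <= v n <= 1 by rewrite v0 ltW.
rewrite [leRHS]ger0_norm; last by rewrite addr_ge0// mulr_ge0// sqr_ge0.
rewrite -{2}[1 - v n ^+ N]mul1r -mulrDl normrM (ger0_norm h1) ler_wpM2r//.
set z := ln _; have [z0|z0] := leP 0 z.
  by rewrite ger0_norm//; nra.
by rewrite ltr0_norm//; nra.
Qed.

Let cvg_harmonic_poly N :
  harmonic_poly N (v n) @[n --> \oo] --> \sum_(k < N) (k.+1%:R^-1 : R).
Proof.
rewrite /harmonic_poly; elim: N => [|N IH].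
  by rewrite big_ord0; under eq_fun do rewrite big_ord0; exact: cvg_cst.
under eq_fun do rewrite big_ord_recr/=; rewrite big_ord_recr/=.
apply: cvgD => //; rewrite -[X in _ --> X]mul1r.
by apply: cvgMl; exact: cvg_exp1.
Qed.

Lemma cvg_psi1 N :
  psi1 N (v n) @[n --> \oo] --> \sum_(k < N) (k.+1%:R^-1 : R).
Proof.
by rewrite -[X in _ --> X]add0r; apply: cvgD (cvg_ln _) (cvg_harmonic_poly _).
Qed.

Lemma cvg_psi2 N : psi2 N (v n) @[n --> \oo] -->
  (\sum_(k < N) k.+1%:R^-1) ^+ 2 + \sum_(k < N) (k.+1%:R ^- 2 : R).
Proof.
rewrite -[X in _ --> X]add0r -{1}oppr0; apply: cvgD; first by apply: cvgN; exact: cvg_ln2.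
elim: N => [|N IH].
  rewrite !big_ord0 expr0n addr0.
  by under eq_fun do rewrite big_ord0; exact: cvg_cst.
under eq_fun do rewrite big_ord_recr/=.
set H := \sum_(k < N) _ in IH; set S := \sum_(k < N) _ in IH.
(* From N to N + 1 the square gains 2 H_N / (N + 1) + 1 / (N + 1)^2 and the sum gains 1 / (N + 1)^2.
   Together this is 2 H_(N+1) / (N + 1), the limit of the new summand of [psi2]. *)
rewrite (_ : _ + _ = H ^+ 2 + S + 2 / N.+1%:R * \sum_(k < N.+1) (k.+1%:R^-1 : R)).
  apply: cvgD => //; apply: cvgMr; exact: cvg_psi1.
by rewrite !big_ord_recr/= -/H -/S; field; rewrite nat1r.
Qed.

End limits.
End psi.

(** * The Gumbel cdf and its roots *)

Section gumbel_cdf.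
Context {R : realType}.
Implicit Types (x : R) (n : nat).

Definition gumbel_cdf x : R := expR (- expR (- x)).

(** The (n+1)-th root of [gumbel_cdf]. Evaluated at a Gumbel variable, it has the law of the maximum
    of n + 1 uniform variables. *)
Definition root_cdf n x : R := expR (- (expR (- x) / n.+1%:R)).

(* If [X] is Gumbel, [exp_max n X] is distributed as the maximum of [n + 1]
   independent standard exponential variables. *)
Definition exp_max n x : R := - ln (1 - root_cdf n x).

Lemma root_cdf01 n x : 0 < root_cdf n x < 1.
Proof. by rewrite expR_gt0 expR_lt1 oppr_lt0 divr_gt0// expR_gt0. Qed.

Lemma root_cdfX n x : root_cdf n x ^+ n.+1 = gumbel_cdf x.
Proof. by rewrite -expRM_natr mulNr divfK// pnatr_eq0. Qed.

Lemma exp_max_ge0 n x : 0 <= exp_max n x.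
Proof.
have /andP[r0 r1] := root_cdf01 n x.
by rewrite /exp_max oppr_ge0 ln_le0//; lra.
Qed.

Lemma is_derive_expRN x : is_derive x 1 (fun y => expR (- y)) (- expR (- x)).
Proof.
have := is_derive_fcomp (fun y => - y) (is_derive_expR (- x)) (is_derive_fN (is_derive_fid x)).
by rewrite mulrN1.
Qed.

Lemma is_derive_root_cdf n x :
  is_derive x 1 (root_cdf n) (root_cdf n x * (expR (- x) / n.+1%:R)).
Proof.
have d1 := is_derive_fN (is_derive_fM (is_derive_expRN x) (is_derive_fcst n.+1%:R^-1 x)).
have d2 := is_derive_fcomp (fun y => - (expR (- y) / n.+1%:R)) (is_derive_expR (- (expR (- x) / n.+1%:R))) d1.
apply: (is_derive_eq d2).
by rewrite /root_cdf; ring.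
Qed.

Lemma is_derive_gumbel_cdf x :
  is_derive x 1 gumbel_cdf (expR (- x) * gumbel_cdf x).
Proof.
have d2 := is_derive_fcomp (fun y => - expR (- y)) (is_derive_expR (- expR (- x)))
  (is_derive_fN (is_derive_expRN x)).
by apply: (is_derive_eq d2); rewrite opprK mulrC.
Qed.

Lemma continuous_exp_max n : continuous (exp_max n).
Proof.
move=> x; have /andP[_ r1] := root_cdf01 n x.
exact: (is_derive_continuous _ _ _ (is_derive_fN
  (is_derive_fcomp (root_cdf n) (is_derive_ln1B _ r1) (is_derive_root_cdf n x)))).
Qed.

Lemma cvg_root_cdfy n : root_cdf n m%:R @[m --> \oo] --> (1 : R).
Proof.
have c : - (expR (- m%:R) / n.+1%:R) @[m --> \oo] --> (0 : R).
  rewrite -[X in _ --> X]oppr0; apply: cvgN.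
  rewrite -[X in _ --> X](mul0r n.+1%:R^-1).
  by apply: cvgMl; exact: cvgn_expR.
rewrite -[X in _ --> X](@expR0 R).
exact: (cvg_comp _ (@expR R) c (@continuous_expR R 0)).
Qed.

Lemma cvg_root_cdfNy n : root_cdf n (- m%:R) @[m --> \oo] --> (0 : R).
Proof.
have c : n.+1%:R * expR (- m%:R) @[m --> \oo] --> (0 : R).
  by rewrite -[X in _ --> X](mulr0 n.+1%:R); apply: cvgMr; exact: cvgn_expR.
apply: (squeeze_cvgr _ (cvg_cst 0) c); apply: nearW => m.
have /andP[/ltW -> _] /= := root_cdf01 n (- m%:R).
rewrite /root_cdf opprK !expRN; set e := expR m%:R.
have e0 : 0 < e / n.+1%:R by rewrite divr_gt0// expR_gt0.
rewrite (_ : n.+1%:R * e^-1 = (e / n.+1%:R)^-1); last by rewrite invf_div.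
rewrite lef_pV2 ?posrE ?expR_gt0//; apply: le_trans (expR_ge1Dx _).
by rewrite ler_wpDl.
Qed.

Lemma cvg_gumbel_cdfy : gumbel_cdf m%:R @[m --> \oo] --> (1 : R).
Proof.
have := cvg_root_cdfy 0; under eq_fun do rewrite -[root_cdf _ _]expr1 root_cdfX.
exact.
Qed.

Lemma cvg_gumbel_cdfNy : gumbel_cdf (- m%:R) @[m --> \oo] --> (0 : R).
Proof.
have := cvg_root_cdfNy 0; under eq_fun do rewrite -[root_cdf _ _]expr1 root_cdfX.
exact.
Qed.

End gumbel_cdf.

(** * Integrals under a Gumbel law of mass [q] on a set [D] *)

Section gumbel_law.
Context d (T : measurableType d) (R : realType) (mu : {measure set T -> \bar R}).
Variables (D : set T) (X : T -> R) (q : R).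
Hypotheses (mD : measurable D) (mX : measurable_fun setT X).
Hypothesis Xq : forall x, mu (D `&` [set t | X t <= x]) = (q * gumbel_cdf x)%:E.

Let dF (x : R) : is_derive x 1 (fun x => q * gumbel_cdf x)
  (q * (expR (- x) * gumbel_cdf x)).
Proof.
apply: (is_derive_eq (is_derive_fM (is_derive_fcst q x) (is_derive_gumbel_cdf x))).
by rewrite mulr0 addr0.
Qed.

Lemma gumbel_mass : mu D = q%:E.
Proof.
rewrite -[LHS]mul1e -integral_cst//.
have d1 (x : R) : is_derive x 1 (fun x => q * gumbel_cdf x)
    (cst 1 x * (q * (expR (- x) * gumbel_cdf x))).
  by rewrite mul1r; exact: dF.
have c1 : q * gumbel_cdf n%:R @[n --> \oo] --> q.
  by rewrite -[X in _ --> X]mulr1; apply: cvgMr; exact: cvg_gumbel_cdfy.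
have c0 : q * gumbel_cdf (- n%:R) @[n --> \oo] --> 0.
  by rewrite -[X in _ --> X](mulr0 q); apply: cvgMr; exact: cvg_gumbel_cdfNy.
have cg : continuous (cst 1 : R -> R) by move=> x; exact: cvg_cst.
have := integral_law _ _ _ _ _ _ _ mD mX Xq _ (cst 1) _ _ _ dF cg
  (fun=> ler01) d1 c1 c0.
by rewrite subr0.
Qed.

Let r01 n (x : R) : 0 <= root_cdf n x < 1.
Proof. by have /andP[/ltW -> ->] := @root_cdf01 R n x. Qed.

(** Under v = [root_cdf n x], the differential of the cdf becomes q d(v^(n+1)), so [psi1] composed
    with [root_cdf] is a primitive; its limit at v = 1 is the harmonic number. *)
Lemma integral_exp_max n : (\int[mu]_(t in D) (exp_max n (X t))%:E =
  (q * \sum_(k < n.+1) k.+1%:R^-1)%:E)%E.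
Proof.
have d1 (x : R) : is_derive x 1 (fun x => q * psi1 n.+1 (root_cdf n x))
    (exp_max n x * (q * (expR (- x) * gumbel_cdf x))).
  have /andP[_ r1] := r01 n x.
  apply: (is_derive_eq (is_derive_fM (is_derive_fcst q x)
    (is_derive_fcomp (root_cdf n) (is_derive_psi1 n.+1 _ r1) (is_derive_root_cdf n x)))).
  have N0 : n.+1%:R != 0 :> R by rewrite pnatr_eq0.
  by rewrite -(root_cdfX n) /exp_max (exprS (root_cdf n x)) /=; field; rewrite nat1r.
have c1 : q * psi1 n.+1 (root_cdf n m%:R) @[m --> \oo] -->
    q * \sum_(k < n.+1) k.+1%:R^-1.
  apply: cvgMr; apply: (cvg_psi1 (fun m => root_cdf n m%:R)).
    by move=> m; exact: r01.
  exact: cvg_root_cdfy.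
have c0 : q * psi1 n.+1 (root_cdf n (- m%:R)) @[m --> \oo] --> 0.
  rewrite -[X in _ --> X](mulr0 q); apply: cvgMr.
  exact: (proj1 (cvg_psi0 (fun m => root_cdf n (- m%:R)) n.+1 (cvg_root_cdfNy n))).
rewrite -[in RHS](subr0 (q * _)).
exact: (integral_law _ _ _ _ _ _ _ mD mX Xq _ (exp_max n) _ _ _ dF
  (@continuous_exp_max _ n) (exp_max_ge0 n) d1 c1 c0).
Qed.

Lemma integral_exp_max2 n : (\int[mu]_(t in D) (exp_max n (X t) ^+ 2)%:E =
  (q * ((\sum_(k < n.+1) k.+1%:R^-1) ^+ 2 + \sum_(k < n.+1) k.+1%:R ^- 2))%:E)%E.
Proof.
have d1 (x : R) : is_derive x 1 (fun x => q * psi2 n.+1 (root_cdf n x))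
    (exp_max n x ^+ 2 * (q * (expR (- x) * gumbel_cdf x))).
  have /andP[_ r1] := r01 n x.
  apply: (is_derive_eq (is_derive_fM (is_derive_fcst q x)
    (is_derive_fcomp (root_cdf n) (is_derive_psi2 n.+1 _ r1) (is_derive_root_cdf n x)))).
  have N0 : n.+1%:R != 0 :> R by rewrite pnatr_eq0.
  by rewrite -(root_cdfX n) /exp_max (exprS (root_cdf n x)) /=; field; rewrite nat1r.
have c1 : q * psi2 n.+1 (root_cdf n m%:R) @[m --> \oo] -->
    q * ((\sum_(k < n.+1) k.+1%:R^-1) ^+ 2 + \sum_(k < n.+1) k.+1%:R ^- 2).
  apply: cvgMr; apply: (cvg_psi2 (fun m => root_cdf n m%:R)).
    by move=> m; exact: r01.
  exact: cvg_root_cdfy.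
have c0 : q * psi2 n.+1 (root_cdf n (- m%:R)) @[m --> \oo] --> 0.
  rewrite -[X in _ --> X](mulr0 q); apply: cvgMr.
  exact: (proj2 (cvg_psi0 (fun m => root_cdf n (- m%:R)) n.+1 (cvg_root_cdfNy n))).
have cg : continuous (fun x : R => exp_max n x ^+ 2).
  move=> x; apply: (cvg_comp (exp_max n) (fun y => y ^+ 2) (@continuous_exp_max R n x)).
  exact: exprn_continuous.
rewrite -[in RHS](subr0 (q * _)).
exact: (integral_law _ _ _ _ _ _ _ mD mX Xq _ (fun x => exp_max n x ^+ 2) _ _ _ dF
  cg (fun x => sqr_ge0 _) d1 c1 c0).
Qed.

(** Under the normalised law, [expR (- X)] is a standard exponential variable, of mean 1. It later
    dominates the squares in the lower tail. *)
Lemma integral_expRN : (\int[mu]_(t in D) (expR (- X t))%:E = q%:E)%E.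
Proof.
have d1 (x : R) : is_derive x 1 (fun x => q * ((expR (- x) + 1) * gumbel_cdf x))
    (expR (- x) * (q * (expR (- x) * gumbel_cdf x))).
  apply: (is_derive_eq (is_derive_fM (is_derive_fcst q x) (is_derive_fM
   (is_derive_fD (is_derive_expRN x) (is_derive_fcst 1 x)) (is_derive_gumbel_cdf x)))).
  by rewrite /=; ring.
have c1 : q * ((expR (- m%:R) + 1) * gumbel_cdf m%:R) @[m --> \oo] --> q.
  rewrite -[X in _ --> X]mulr1 -[in X in _ --> X](mulr1 1) -[in X in X * 1](add0r 1).
  apply: cvgMr; apply: cvgM; last exact: cvg_gumbel_cdfy.
  by apply: cvgD; [exact: cvgn_expR|exact: cvg_cst].
have c0 : q * ((expR (- - m%:R) + 1) * gumbel_cdf (- m%:R)) @[m --> \oo] --> 0.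
  rewrite -[X in _ --> X](mulr0 q); apply: cvgMr.
  have c : 4 * expR (- m%:R) @[m --> \oo] --> (0 : R).
    by rewrite -[X in _ --> X](mulr0 4); apply: cvgMr; exact: cvgn_expR.
  (* With u = e^m, the bound (u + 1) e^(-u) <= 4 / u follows from e^u >= 1 + u^2 / 2. *)
  apply: (squeeze_cvgr _ (cvg_cst 0) c); apply: nearW => m.
  rewrite mulr_ge0 ?addr_ge0 ?expR_ge0//=.
  rewrite /gumbel_cdf opprK !expRN; set u := expR m%:R.
  have u0 : 0 < u by exact: expR_gt0.
  have := expR_ge1Dxn 1 (ltW u0); rewrite -/u (_ : 2`! = 2%N)// => uE.
  rewrite ler_pdivrMr ?expR_gt0// -mulrA mulrCA ler_pdivlMl//.
  by nra.
rewrite -[in RHS](subr0 q).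
exact: (integral_law _ _ _ _ _ _ _ mD mX Xq _ (fun x => expR (- x)) _ _ _ dF
  (fun x => is_derive_continuous _ _ _ (is_derive_expRN x)) (fun x => expR_ge0 _) d1 c1 c0).
Qed.

End gumbel_law.

(** * The Basel problem *)

Section basel.
Context {R : realType}.
Implicit Types x : R.

(** By the mean value theorem sin x = x cos c with 0 < c < x, and cos decreases. *)
Lemma sin_pos_bounds x : 0 < x < pi / 2 -> x * cos x <= sin x <= x.
Proof.
move=> /andP[x0 x2].
have [|c cx e] := @MVT R sin cos 0 x x0 (fun z _ => is_derive_sin z).
  by apply: continuous_subspaceT => z; exact: continuous_sin.
move: e cx; rewrite sin0 !subr0 in_itv/= => -> /andP[c0 cx].
rewrite (mulrC x) ler_pM2r// ger_pMl// cos_le1 andbT.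
have := pi_gt0 R => p0.
by apply: ltW; rewrite ltr_cos// in_itv/=; apply/andP; split; lra.
Qed.

(** Squaring x cos x <= sin x and replacing cos^2 by 1 - sin^2 gives x^2 <= sin^2 x (1 + x^2), hence
    the upper bound. *)
Lemma csc2_bounds x : 0 < x < pi / 2 -> x ^- 2 <= sin x ^- 2 <= x ^- 2 + 1.
Proof.
move=> x02; have /andP[h1 h2] := sin_pos_bounds _ x02.
have s0 := sin_gt0_pihalf x02.
have /andP[x0 x2] := x02.
have c0 : 0 < cos x by apply: cos_gt0_pihalf; apply/andP; split; lra.
apply/andP; split.
  by rewrite lef_pV2 ?posrE ?exprn_gt0// lerXn2r// nnegrE ltW.
have : x ^+ 2 <= sin x ^+ 2 * (1 + x ^+ 2).
  have : (x * cos x) ^+ 2 <= sin x ^+ 2.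
    by rewrite lerXn2r// nnegrE ltW// mulr_gt0.
  rewrite exprMn cos2sin2; nra.
move=> h3; rewrite -subr_ge0.
have -> : x ^- 2 + 1 - sin x ^- 2 = (sin x ^+ 2 * (1 + x ^+ 2) - x ^+ 2) / (sin x ^+ 2 * x ^+ 2).
  by field; rewrite !gt_eqF.
by rewrite divr_ge0 ?subr_ge0// mulr_ge0// sqr_ge0.
Qed.

(** The second sine is cos (x / 2), and 1 / s^2 + 1 / c^2 = 1 / (s c)^2 while sin x = 2 s c. *)
Lemma csc2_halve x : 0 < x < pi ->
  sin (x / 2) ^- 2 + sin ((pi - x) / 2) ^- 2 = 4 * sin x ^- 2.
Proof.
move=> /andP[x0 xpi].
rewrite (_ : (pi - x) / 2 = - (x / 2) + pi / 2); last by field.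
rewrite sinDpihalf cosN.
have -> : sin x = 2 * cos (x / 2) * sin (x / 2).
  rewrite -[X in sin X](_ : (x / 2) *+ 2 = x); last by rewrite -mulr_natr; field.
  by rewrite sin_mulr2n -mulr_natl mulrA.
have s0 : 0 < sin (x / 2) by apply: sin_gt0_pihalf; apply/andP; split; lra.
have c0 : 0 < cos (x / 2) by apply: cos_gt0_pihalf; apply/andP; split; lra.
have := cos2Dsin2 (x / 2).
move: (cos _) (sin _) c0 s0 => c s c0 s0 cs.
have -> : s ^- 2 + c ^- 2 = (c ^+ 2 + s ^+ 2) / (c ^+ 2 * s ^+ 2).
  by field; rewrite !gt_eqF.
by rewrite cs; field; rewrite !gt_eqF.
Qed.

Lemma sum_fold_half (V : zmodType) m (F : nat -> V) :
  \sum_(k < m + m) F k = \sum_(k < m) (F k + F (m + m - k.+1)%N).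
Proof.
rewrite big_split_ord/= big_split/=; congr (_ + _).
rewrite (reindex_inj rev_ord_inj)/=; apply: eq_bigr => i _; congr F.
by rewrite addnBA.
Qed.

(** At level n + 1 the terms k and 2^(n+1) - 1 - k have angles x / 2 and (pi - x) / 2, where x is
    the k-th angle at level n. By [csc2_halve] each such pair is 4 times the old term. The start is
    1 / sin^2 (pi / 4) = 2. *)
Lemma sum_csc2 n :
  \sum_(k < 2 ^ n) sin (k.*2.+1%:R * (pi / 2 ^+ n.+2)) ^- 2 = 2 * 4 ^+ n :> R.
Proof.
have := @pi_gt0 R => p0.
elim: n => [|n IH].
  rewrite big_ord1 mul1r expr0 mulr1 -[RHS]mulr1.
  have := csc2_halve (pi / 2) ltac:(apply/andP; split; lra).
  rewrite sin_pihalf expr1n invr1 (_ : (pi - pi / 2) / 2 = pi / 2 ^+ 2); last by field.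
  rewrite (_ : pi / 2 / 2 = pi / 2 ^+ 2); last by field.
  lra.
have := congr1 (fun z => 4 * z) IH; rewrite mulrCA -exprS => <-.
rewrite expnS mul2n -addnn (sum_fold_half _ _ (fun k => sin (k.*2.+1%:R * (pi / 2 ^+ n.+3)) ^- 2)).
rewrite mulr_sumr; apply: eq_bigr => k _.
have k2 : (k.*2.+1 < 2 ^ n.+2)%N.
  by rewrite !expnS !mul2n; have := ltn_ord k; lia.
have t0 : 0 < pi / 2 ^+ n.+2 :> R by rewrite divr_gt0// exprn_gt0.
have kpi : k.*2.+1%:R * (pi / 2 ^+ n.+2) < pi :> R.
  rewrite mulrCA gtr_pMr// ltr_pdivrMr ?exprn_gt0// mul1r.
  by rewrite -natrX ltr_nat.
rewrite -csc2_halve; last by rewrite kpi andbT mulr_gt0.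
congr (sin _ ^- 2 + sin _ ^- 2).
  by rewrite (exprS _ n.+2); field; rewrite expf_neq0.
have -> : (2 ^ n + 2 ^ n - k.+1).*2.+1%:R = 2 ^+ n.+2 - k.*2.+1%:R :> R.
  rewrite -natrX -natrB ?(ltnW k2)//; congr (_%:R).
  by rewrite !expnS; have := ltn_ord k; lia.
by rewrite (exprS _ n.+2); field; rewrite expf_neq0.
Qed.

Let odd_sum m : R := \sum_(k < m) k.*2.+1%:R ^- 2.
Definition inv2_sum m : R := \sum_(k < m) k.+1%:R ^- 2.

(** Summing [csc2_bounds] over the angles (2 k + 1) t with t = pi / 2^(n+2) places the closed form
    of [sum_csc2] between [odd_sum] / t^2 and the same plus 2^n; it remains to multiply by t^2. *)
Let odd_sum_bounds n :
  pi ^+ 2 / 8 - pi ^+ 2 / 16 * 2^-1 ^+ n <= odd_sum (2 ^ n) <= pi ^+ 2 / 8.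
Proof.
have := @pi_gt0 R => p0.
pose t : R := pi / 2 ^+ n.+2.
have t0 : 0 < t by rewrite divr_gt0// exprn_gt0.
have tk (k : 'I_(2 ^ n)) : 0 < k.*2.+1%:R * t < pi / 2.
  rewrite mulr_gt0//= /t mulrCA ltr_pM2l// ltr_pdivrMr ?exprn_gt0//.
  rewrite exprS mulrA mulVf// mul1r -natrX ltr_nat expnS.
  by have := ltn_ord k; lia.
have lo : t ^- 2 * odd_sum (2 ^ n) <= 2 * 4 ^+ n.
  rewrite -sum_csc2 mulr_sumr; apply: ler_sum => k _.
  by have /andP[h _] := csc2_bounds _ (tk k); rewrite -invfM -exprMn (mulrC t).
have hi : 2 * 4 ^+ n <= t ^- 2 * odd_sum (2 ^ n) + 2 ^+ n.
  have -> : 2 ^+ n = \sum_(k < 2 ^ n) 1 :> R.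
    by rewrite sumr_const card_ord -natrX.
  rewrite -sum_csc2 mulr_sumr -big_split/=; apply: ler_sum => k _.
  by have /andP[_ h] := csc2_bounds _ (tk k); rewrite -invfM -exprMn (mulrC t).
have t2 : t ^+ 2 = pi ^+ 2 / 16 / 4 ^+ n.
  rewrite /t !exprS expr0 (_ : 4 = 2 * 2 :> R) ?exprMn; last by ring.
  by field; rewrite expf_neq0.
have t20 : 0 < t ^+ 2 by rewrite exprn_gt0.
have n2 : (4 : R) ^+ n = 2 ^+ n * 2 ^+ n by rewrite -exprMn; congr (_ ^+ _); ring.
have e2 : 2^-1 ^+ n = (2 ^+ n)^-1 :> R by rewrite exprVn.
rewrite (mulrC (t ^- 2)) ler_pdivrMr// in lo.
rewrite (mulrC (t ^- 2)) -lerBlDr ler_pdivlMr// in hi.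
have n0 : (2 : R) ^+ n != 0 by rewrite expf_neq0.
apply/andP; split.
  by apply: le_trans hi; rewrite t2 n2 e2 le_eqVlt; apply/orP; left; apply/eqP; field.
by apply: (le_trans lo); rewrite t2 n2 le_eqVlt; apply/orP; left; apply/eqP; field.
Qed.

Let cvg_half_pow : (2^-1 : R) ^+ n @[n --> \oo] --> (0 : R).
Proof. by apply: cvg_expr; rewrite ger0_norm; lra. Qed.

Let cvg_odd_sum : odd_sum (2 ^ n) @[n --> \oo] --> pi ^+ 2 / 8.
Proof.
have c : pi ^+ 2 / 8 - pi ^+ 2 / 16 * 2^-1 ^+ n @[n --> \oo] --> (pi ^+ 2 / 8 : R).
  rewrite -[X in _ --> X]subr0; apply: cvgB; first exact: cvg_cst.
  by rewrite -[X in _ --> X](mulr0 (pi ^+ 2 / 16)); apply: cvgMr.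
by apply: (squeeze_cvgr _ c (cvg_cst _)); apply: nearW => n; exact: odd_sum_bounds.
Qed.

Lemma inv2_sum_le m : inv2_sum m <= 5 / 3.
Proof.
(* Telescoping: 1 / (n + 3/2) - 1 / (n + 5/2) exceeds 1 / (n + 2)^2. The constant 5/3 makes the case
   n = 0 an equality. *)
suff h n : inv2_sum n.+1 <= 5 / 3 - (n%:R + 3 / 2)^-1.
  case: m => [|n]; first by rewrite /inv2_sum big_ord0; lra.
  by apply: le_trans (h n) _; rewrite gerBl invr_ge0 addr_ge0// ?ler0n; lra.
elim: n => [|n IH]; first by rewrite /inv2_sum big_ord1 expr1n invr1 add0r; lra.
rewrite /inv2_sum big_ord_recr/=; apply: le_trans (lerD IH (lexx _)) _.
rewrite -!natr1; have : 0 <= n%:R :> R by rewrite ler0n.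
move: n%:R => x x0.
rewrite -subr_ge0 (_ : _ - _ = (4 * ((x + 2) ^+ 2) * (x + 3 / 2) * (x + 5 / 2))^-1);
  first by rewrite invr_ge0 !mulr_ge0 ?sqr_ge0; lra.
field; apply/and3P; split; apply: lt0r_neq0; lra.
Qed.

Let inv2_sum_double m : inv2_sum (m + m) = odd_sum m + inv2_sum m / 4.
Proof.
elim: m => [|m IH]; first by rewrite /odd_sum /inv2_sum !big_ord0 mul0r addr0.
rewrite addSn addnS /inv2_sum 2!big_ord_recr/= -/(inv2_sum _) IH.
rewrite /odd_sum big_ord_recr/= big_ord_recr/= -/(odd_sum _) -/(inv2_sum _).
rewrite addnn -!natr1 -!mul2n natrM.
have : 0 <= m%:R :> R by rewrite ler0n.
move: m%:R => x x0; field.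
by apply/and3P; split; apply: lt0r_neq0; lra.
Qed.

(** The partial sums at 2^n and at twice 2^n have the same limit z, while splitting into odd and
    even denominators gives z = pi^2 / 8 + z / 4. *)
Lemma cvg_inv2_sum : inv2_sum n @[n --> \oo] --> pi ^+ 2 / 6.
Proof.
have nd : nondecreasing_seq inv2_sum.
  apply/nondecreasing_seqP => n; rewrite /inv2_sum big_ord_recr/= lerDl.
  by rewrite invr_ge0 sqr_ge0.
have : cvgn inv2_sum.
  apply: nondecreasing_is_cvgn => //; exists (5 / 3) => _ [n _ <-].
  exact: inv2_sum_le.
move/cvg_ex => [z cz].
have p2 : (2 ^ n)%N @[n --> \oo] --> \oo.
  apply/cvgnyPge => M; near=> n; apply: leq_trans (ltnW (ltn_expl n (ltnSn 1))).
  by near: n; exact: nbhs_infty_ge.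
have c1 : inv2_sum (2 ^ n) @[n --> \oo] --> z by exact: (cvg_comp _ _ p2 cz).
have c2 : inv2_sum (2 ^ n + 2 ^ n) @[n --> \oo] --> z.
  apply: (cvg_comp (fun n => 2 ^ n + 2 ^ n)%N inv2_sum _ cz).
  apply/cvgnyPge => M; near=> n; apply: leq_trans (leq_addr _ _).
  apply: leq_trans (ltnW (ltn_expl n (ltnSn 1))).
  by near: n; exact: nbhs_infty_ge.
have c3 : inv2_sum (2 ^ n + 2 ^ n) @[n --> \oo] --> pi ^+ 2 / 8 + z / 4.
  under eq_fun do rewrite inv2_sum_double.
  by apply: cvgD cvg_odd_sum _; exact: cvgMl.
have e : z = pi ^+ 2 / 8 + z / 4 by apply: (cvg_unique _ c2 c3).
have <- : z = pi ^+ 2 / 6 by lra.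
exact: cz.
Unshelve. all: by end_near. Qed.

End basel.

(** * The Euler-Mascheroni constant *)

Section euler_gamma.
Context {R : realType}.

(** The sequence that defines [euler_gamma], shifted by one so that it starts at ln 1. *)
Definition harmonic_ln n : R := \sum_(k < n.+1) k.+1%:R^-1 - ln n.+1%:R.

Let lnS n : ln n.+2%:R - ln n.+1%:R = ln (1 + n.+1%:R^-1) :> R.
Proof.
have -> : n.+2%:R = n.+1%:R * (1 + n.+1%:R^-1) :> R.
  by rewrite mulrDr mulr1 divff ?pnatr_eq0// natr1.
by rewrite lnM ?posrE ?ltr0n// ?addr_gt0// ?invr_gt0 ?ltr0n//; ring.
Qed.

Let lnS_ge n : n.+2%:R^-1 <= ln n.+2%:R - ln n.+1%:R :> R.
Proof.
rewrite -opprB -ln_div ?posrE ?ltr0n// lerNr.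
have -> : n.+1%:R / n.+2%:R = 1 + - n.+2%:R^-1 :> R.
  by rewrite -[n.+2%:R]natr1; field.
by apply: le_ln1Dx; rewrite ltrN2 invf_lt1 ?ltr0n// ltr1n.
Qed.

Lemma harmonic_ln_nonincreasing : nonincreasing_seq harmonic_ln.
Proof.
apply/nonincreasing_seqP => n; rewrite /harmonic_ln big_ord_recr/=.
by have := lnS_ge n; move: (ln n.+2%:R) (ln n.+1%:R) n.+2%:R^-1 => a b c; lra.
Qed.

Lemma harmonic_ln_ge0 n : 0 <= harmonic_ln n.
Proof.
(* The added 1 / (n + 1) absorbs the increment ln (1 + 1 / (n + 1)) of the logarithm in the
   induction. *)
suff : ln n.+1%:R + n.+1%:R^-1 <= \sum_(k < n.+1) k.+1%:R^-1 :> R.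
  rewrite /harmonic_ln subr_ge0; apply: le_trans.
  by rewrite lerDl invr_ge0.
elim: n => [|n IH]; first by rewrite big_ord1 ln1 add0r.
rewrite big_ord_recr/= lerD2r.
have : ln (1 + n.+1%:R^-1) <= n.+1%:R^-1 :> R.
  by apply: le_ln1Dx; apply: lt_le_trans (_ : 0 <= _); rewrite ?ltrN10 ?invr_ge0.
by rewrite -lnS; move: IH; move: (ln n.+2%:R) (ln n.+1%:R) n.+1%:R^-1 => a b c; lra.
Qed.

Lemma cvg_harmonic_ln : harmonic_ln n @[n --> \oo] --> euler_gamma R.
Proof.
have c : cvgn harmonic_ln.
  apply: nonincreasing_is_cvgn; first exact: harmonic_ln_nonincreasing.
  by exists 0 => _ [n _ <-]; exact: harmonic_ln_ge0.
suff -> : euler_gamma R = limn harmonic_ln by exact: c.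
rewrite /euler_gamma; apply: cvg_lim => //.
rewrite -(cvg_shiftS (fun n : nat => \sum_(1 <= k < n.+1) (k%:R : R)^-1 - ln (n%:R : R))).
suff -> : (fun n : nat => \sum_(1 <= k < n.+2) (k%:R : R)^-1 - ln (n.+1%:R : R)) = harmonic_ln by exact: c.
by apply/funext => n; rewrite big_add1/= big_mkord.
Qed.

Lemma euler_gamma_ge0 : 0 <= euler_gamma R.
Proof.
apply: (ler_cvg_to (cvg_cst 0) cvg_harmonic_ln).
by apply: nearW; exact: harmonic_ln_ge0.
Qed.

Lemma ln2_ge : 2 / 3 <= ln 2 :> R.
Proof.
rewrite -ler_expR lnK ?posrE//.
rewrite -[2 / 3]opprK expRN -[leRHS]invrK lef_pV2 ?posrE ?expR_gt0 ?invr_gt0//.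
(* Nine factors suffice: e^(-2/27) >= 25/27, and (25/27)^9 is just above 1/2. *)
have -> : - (2 / 3) = - (2 / 27) * 9%:R :> R by field.
rewrite expRM_natr; apply: (@le_trans _ _ ((1 + - (2 / 27)) ^+ 9)); first by lra.
by rewrite lerXn2r ?nnegrE ?expR_ge0 ?expR_ge1Dx//; lra.
Qed.

(** The sequence decreases to its limit, and its second term is 3/2 - ln 2 <= 3/2 - 2/3. *)
Lemma euler_gamma_le : euler_gamma R <= 5 / 6.
Proof.
apply: (@le_trans _ _ (harmonic_ln 1)); last first.
  rewrite /harmonic_ln !big_ord_recr/= big_ord0; have := ln2_ge; lra.
apply: (ler_cvg_to cvg_harmonic_ln (cvg_cst _)).
near=> n; apply: harmonic_ln_nonincreasing; near: n; exact: nbhs_infty_ge.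
Unshelve. all: by end_near. Qed.

End euler_gamma.

(** * Moments of the Gumbel law *)

Section has_integral.
Context {d} {T : measurableType d} {R : realType} {mu : {measure set T -> \bar R}}.
Context {D : set T} (mD : measurable D).
Implicit Types f g : T -> R.

(** Integrability and value travel together, so that linear combinations carry both at once. *)
Definition has_integral f (I : R) :=
  mu.-integrable D (EFin \o f) /\ (\int[mu]_(t in D) (f t)%:E)%E = I%:E.

Lemma has_integralD {f g I J} : has_integral f I -> has_integral g J ->
  has_integral (fun t => f t + g t) (I + J).
Proof.
move=> [fi fI] [gi gJ]; split; first exact: (integrableD mD fi gi).
under eq_integral do rewrite EFinD.
by rewrite integralD//= fI gJ EFinD.
Qed.

Lemma has_integralZ {f I} c : has_integral f I ->
  has_integral (fun t => c * f t) (c * I).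
Proof.
move=> [fi fI]; split; first exact: (integrableZl mD c fi).
under eq_integral do rewrite EFinM.
by rewrite integralZl//= fI EFinM.
Qed.

Lemma has_integral_cst {q} c : mu D = q%:E -> has_integral (fun=> c) (c * q).
Proof.
move=> Dq; split; last by rewrite integral_cst// Dq EFinM.
apply/integrableP; split; first exact: measurable_cst.
rewrite (_ : (fun x => _) = cst `|c|%:E)//= integral_cst// Dq.
by rewrite -EFinM ltry.
Qed.

Lemma has_integral_ge0 {f I} : measurable_fun D f -> (forall t, 0 <= f t) ->
  (\int[mu]_(t in D) (f t)%:E)%E = I%:E -> has_integral f I.
Proof.
move=> mf f0 fI; split => //; apply/integrableP; split; first exact/measurable_EFinP.
under eq_integral => t _ do rewrite /= ger0_norm//.
by rewrite fI ltry.
Qed.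

Lemma has_integral_ext {f g I} : f =1 g -> has_integral f I -> has_integral g I.
Proof. by move=> /funext ->. Qed.

Lemma has_integral_dominated {f_ : nat -> T -> R} {f g} {I_ : nat -> R} {I J} :
  measurable_fun D f ->
  (forall n, has_integral (f_ n) (I_ n)) -> has_integral g J ->
  (forall n t, `|f_ n t| <= g t) ->
  (forall t, f_ n t @[n --> \oo] --> f t) -> I_ n @[n --> \oo] --> I ->
  has_integral f I.
Proof.
move=> mf fI [gi _] fg ff II.
have m_ n : measurable_fun D (EFin \o f_ n) by have [/integrableP[]] := fI n.
have mE : measurable_fun D (EFin \o f) by exact/measurable_EFinP.
have cE : {ae mu, forall t, D t -> (EFin \o f_ n) t @[n --> \oo] --> (EFin \o f) t}.
  by apply: aeW => t _; apply: cvg_EFin; [exact: nearW|exact: ff].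
have fgE : {ae mu, forall t n, D t -> (`|(EFin \o f_ n) t| <= (EFin \o g) t)%E}.
  by apply: aeW => t n _; rewrite /= lee_fin.
have [fi _ c] := dominated_convergence mD m_ mE cE gi fgE.
split => //.
have cI : (I_ n)%:E @[n --> \oo] --> I%:E by apply: cvg_EFin; [exact: nearW|].
apply: (cvg_unique _ c) => //.
suff -> : [sequence (\int[mu]_(x in D) (EFin \o f_ n) x)%E]_n = (fun n => (I_ n)%:E) by [].
by apply/funext => n; have [] := fI n.
Qed.

End has_integral.
Arguments has_integral {d T R} mu D f I.

(** * Centred exponential maxima compared with their limit *)

Section exp_max_bounds.
Context {R : realType}.
Implicit Types (x : R) (n : nat).

(** Uses 1 - e^(-a) <= a for a = e^(-x) / (n + 1), where - ln a = x + ln (n + 1). *)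
Lemma exp_max_ge n x : x <= exp_max n x - ln n.+1%:R.
Proof.
have /andP[r0 r1] := root_cdf01 n x.
have a0 : 0 < expR (- x) / n.+1%:R by rewrite divr_gt0// expR_gt0.
rewrite /exp_max lerBrDr lerNr opprD -[- x]expRK -ln_div ?posrE ?expR_gt0//.
rewrite ler_ln ?posrE ?subr_gt0//.
have := expR_ge1Dx (- (expR (- x) / n.+1%:R)); rewrite -/(root_cdf n x).
by move: (expR _ / _) => a; lra.
Qed.

(** With a = e^(-x) / (n + 1), e^a >= 1 + a gives 1 - e^(-a) >= a / (1 + a). *)
Lemma exp_max_le n x :
  exp_max n x - ln n.+1%:R <= x + ln (1 + expR (- x) / n.+1%:R).
Proof.
have /andP[r0 r1] := root_cdf01 n x.
have := expR_ge1Dx (expR (- x) / n.+1%:R).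
have -> : expR (expR (- x) / n.+1%:R) = (root_cdf n x)^-1.
  by rewrite /root_cdf -expRN opprK.
have a0 : 0 < expR (- x) / n.+1%:R by rewrite divr_gt0// expR_gt0.
have xe : x = - ln (expR (- x)) by rewrite expRK opprK.
rewrite /exp_max lerBlDr lerNl.
move: (root_cdf n x) r0 r1 => r r0 r1.
move: (expR (- x)) (expR_gt0 (- x)) a0 xe => u u0 a0 -> h.
have -> : - (- ln u + ln (1 + u / n.+1%:R) + ln n.+1%:R) =
    ln (u / n.+1%:R / (1 + u / n.+1%:R)).
  by rewrite !ln_div ?posrE ?divr_gt0 ?addr_gt0//; ring.
rewrite ler_ln ?posrE ?subr_gt0 ?divr_gt0 ?addr_gt0//.
rewrite ler_pdivrMr ?addr_gt0//.
move: (u / _) a0 h => a a0 h.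
have : (1 + a) * r <= 1 by rewrite -ler_pdivlMr// mul1r.
lra.
Qed.

Lemma exp_max_le_div n x : exp_max n x - ln n.+1%:R <= x + expR (- x) / n.+1%:R.
Proof.
apply: (le_trans (exp_max_le n x)); rewrite lerD2l; apply: le_ln1Dx.
by apply: (@lt_le_trans _ _ 0); rewrite ?ltrN10// divr_ge0// expR_ge0.
Qed.

(** A bound uniform in n: ln (1 + e^(-x)) is at most 1 for x >= 0, and x + ln (1 + e^(-x)) = ln (1 +
    e^x) is at most 1 for x <= 0. *)
Lemma exp_max_le_max n x : exp_max n x - ln n.+1%:R <= Num.max x 0 + 1.
Proof.
have u0 := expR_gt0 (- x).
apply: (le_trans (exp_max_le n x)).
have le1 : ln (1 + expR (- x) / n.+1%:R) <= ln (1 + expR (- x)).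
  rewrite ler_ln ?posrE ?addr_gt0 ?divr_gt0// lerD2l ler_pdivrMr//.
  by rewrite ler_peMr ?(ltW u0) ?ler1n.
apply: (@le_trans _ _ (x + ln (1 + expR (- x)))); first by rewrite lerD2l.
have [x0|/ltW x0] := leP 0 x.
  rewrite lerD2l; apply: le_trans (le_ln1Dx _) _; first lra.
  by rewrite expR_le1 oppr_le0.
rewrite add0r -[x in leLHS]expRK -lnM ?posrE ?addr_gt0 ?expR_gt0//.
rewrite expRK mulrDr mulr1 expRxMexpNx_1 addrC.
apply: le_trans (le_ln1Dx _) _; first by have := expR_gt0 x; lra.
by rewrite expR_le1.
Qed.

Lemma cvg_exp_max x : exp_max n x - ln n.+1%:R @[n --> \oo] --> x.
Proof.
have c : x + expR (- x) / n.+1%:R @[n --> \oo] --> x.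
  rewrite -[X in _ --> X]addr0; apply: cvgD; first exact: cvg_cst.
  rewrite -[X in _ --> X](mulr0 (expR (- x))); apply: cvgMr.
  exact: cvg_harmonic.
apply: (squeeze_cvgr _ (cvg_cst x) c); apply: nearW => n.
by rewrite exp_max_ge exp_max_le_div.
Qed.

(** An integrable majorant uniform in n: [exp_max 0 x >= x] controls the upper tail, and e^(-x) >= 1
    + x^2 / 2 the lower one. *)
Lemma exp_max_sqr_le n x : (exp_max n x - ln n.+1%:R) ^+ 2 <=
  4 * expR (- x) + 2 * exp_max 0 x ^+ 2 + 2.
Proof.
have := exp_max_ge n x; have := exp_max_le_max n x.
move: (_ - _) => z; have u0 := expR_gt0 (- x).
have [x0|/ltW x0] := leP 0 x => h1 h2.
  have := exp_max_ge 0 x; rewrite ln1 subr0; move: (exp_max 0 x) => e h3.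
  have : x ^+ 2 <= e ^+ 2 by rewrite lerXn2r// nnegrE; lra.
  have : z ^+ 2 <= (x + 1) ^+ 2 by rewrite lerXn2r// ?nnegrE; lra.
  have := sqr_ge0 (x - 1); rewrite !expr2; lra.
have nx : 0 <= - x by lra.
have := expR_ge1Dxn 1 nx; rewrite (_ : 2`! = 2%N)// sqrrN => h3.
have : z ^+ 2 <= x ^+ 2 + 1.
  have [z0|/ltW z0] := leP 0 z.
    have : z ^+ 2 <= 1 by rewrite expr_le1//; lra.
    have := sqr_ge0 x; lra.
  have : (- z) ^+ 2 <= (- x) ^+ 2 by rewrite lerXn2r ?nnegrE//; lra.
  rewrite !sqrrN; lra.
have := sqr_ge0 (exp_max 0 x); lra.
Qed.

End exp_max_bounds.

Section gumbel_moments.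
Context d (T : measurableType d) (R : realType) (mu : {measure set T -> \bar R}).
Variables (D : set T) (X : T -> R) (q : R).
Hypotheses (mD : measurable D) (mX : measurable_fun setT X).
Hypothesis Xq : forall x, mu (D `&` [set t | X t <= x]) = (q * gumbel_cdf x)%:E.

Let mXD : measurable_fun D X.
Proof. exact: measurable_funTS. Qed.

Let hcst c : has_integral mu D (fun=> c) (c * q).
Proof. exact: (has_integral_cst mD _ (gumbel_mass _ _ _ _ _ _ _ mD mX Xq)). Qed.

Let hE n : has_integral mu D (fun t => exp_max n (X t))
  (q * \sum_(k < n.+1) k.+1%:R^-1).
Proof.
apply: has_integral_ge0.
- apply: measurableT_comp mXD.
  by apply: continuous_measurable_fun; exact: continuous_exp_max.
- by move=> t; exact: exp_max_ge0.
- exact: integral_exp_max.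
Qed.

Let hE2 n : has_integral mu D (fun t => exp_max n (X t) ^+ 2)
  (q * ((\sum_(k < n.+1) k.+1%:R^-1) ^+ 2 + inv2_sum n.+1)).
Proof.
apply: has_integral_ge0.
- apply: measurable_funX; apply: measurableT_comp mXD.
  by apply: continuous_measurable_fun; exact: continuous_exp_max.
- by move=> t; exact: sqr_ge0.
- exact: integral_exp_max2.
Qed.

Let hexp : has_integral mu D (fun t => expR (- X t)) q.
Proof.
apply: has_integral_ge0.
- by apply: measurableT_comp => //; exact: measurable_funN.
- by move=> t; exact: expR_ge0.
- exact: integral_expRN.
Qed.

Let Z n t := exp_max n (X t) - ln n.+1%:R.

Let hZ n : has_integral mu D (Z n) (q * harmonic_ln n).
Proof.
have h := has_integralD mD (hE n) (hcst (- ln n.+1%:R)).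
rewrite (_ : q * _ = q * (\sum_(k < n.+1) k.+1%:R^-1) + - ln n.+1%:R * q) //.
by rewrite /harmonic_ln; ring.
Qed.

Let hZ2 n : has_integral mu D (fun t => Z n t ^+ 2)
  (q * (harmonic_ln n ^+ 2 + inv2_sum n.+1)).
Proof.
have h := has_integralD mD (has_integralD mD (hE2 n)
  (has_integralZ mD (- 2 * ln n.+1%:R) (hE n))) (hcst (ln n.+1%:R ^+ 2)).
rewrite (_ : q * _ = q * ((\sum_(k < n.+1) k.+1%:R^-1) ^+ 2 + inv2_sum n.+1) +
   (- 2 * ln n.+1%:R) * (q * \sum_(k < n.+1) k.+1%:R^-1) + ln n.+1%:R ^+ 2 * q).
  by apply: has_integral_ext h => t; rewrite /Z; ring.
by rewrite /harmonic_ln; ring.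
Qed.

Let hG := has_integralD mD (has_integralD mD
  (has_integralZ mD 4 hexp)
  (has_integralZ mD 2 (hE2 0))) (hcst 2).

Lemma gumbel_moment1 : has_integral mu D X (q * euler_gamma R).
Proof.
apply: (has_integral_dominated mD _ hZ
  (has_integralD mD hG (hcst 1))) => //.
(* Since |z| <= z^2 + 1, the majorant of the squares plus 1 dominates [Z] itself. *)
- move=> n t; have := exp_max_sqr_le n (X t); rewrite -/(Z n t).
  move: (_ + _ + _) => G; have := sqr_ge0 (Z n t - 1); have := sqr_ge0 (Z n t + 1).
  rewrite !expr2 ler_norml; move: (Z n t) => z h1 h2 h3; apply/andP; split; nra.
- by move=> t; exact: cvg_exp_max.
- by apply: cvgMr; exact: cvg_harmonic_ln.
Qed.

Lemma gumbel_moment2 : has_integral mu D (fun t => X t ^+ 2)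
  (q * (euler_gamma R ^+ 2 + pi ^+ 2 / 6)).
Proof.
apply: (has_integral_dominated mD _ hZ2 hG).
- exact: measurable_funX.
- by move=> n t; rewrite ger0_norm ?sqr_ge0// exp_max_sqr_le.
- move=> t; apply: (cvg_comp (fun n => Z n t) (fun z : R => z ^+ 2) (cvg_exp_max (X t))).
  exact: exprn_continuous.
- apply: cvgMr; apply: cvgD.
    apply: (cvg_comp harmonic_ln (fun z : R => z ^+ 2) cvg_harmonic_ln).
    exact: exprn_continuous.
  by have := @cvg_inv2_sum R; rewrite -(cvg_shiftS (@inv2_sum R)).
Qed.

Lemma gumbel_centered_moment c : has_integral mu D (fun t => (X t - c) ^+ 2)
  (q * (pi ^+ 2 / 6 + (euler_gamma R - c) ^+ 2)).
Proof.
have h := has_integralD mD (has_integralD mD gumbel_moment2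
  (has_integralZ mD (- 2 * c) gumbel_moment1)) (hcst (c ^+ 2)).
rewrite (_ : q * _ = q * (euler_gamma R ^+ 2 + pi ^+ 2 / 6) +
   (- 2 * c) * (q * euler_gamma R) + c ^+ 2 * q).
  by apply: has_integral_ext h => t; ring.
by ring.
Qed.

End gumbel_moments.

(** * Law of the score at the argmax *)

Lemma gumbel_cdf_le {R : realType} (x : R) : gumbel_cdf x <= expR x.
Proof.
have -> : expR x = (expR (- x))^-1 by rewrite -expRN opprK.
rewrite /gumbel_cdf expRN lef_pV2 ?posrE ?expR_gt0//.
by apply: le_trans (expR_ge1Dx _); rewrite lerDr.
Qed.

Section softmax.
Context {R : realType} {V : finType} (l : V -> R).

(** The odds (1 - p) / p against [w], for p its softmax probability. *)
Definition rival_weight w : R := \sum_(j | j != w) expR (l j - l w).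

Lemma softmax_invE w : (softmax l w)^-1 = 1 + rival_weight w.
Proof.
rewrite /softmax invf_div (bigD1 w)//= mulrDl divff ?gt_eqF ?expR_gt0//.
by rewrite mulr_suml; congr (_ + _); apply: eq_bigr => j _; rewrite expRB.
Qed.

Lemma rival_weight_ge0 w : 0 <= rival_weight w.
Proof. by apply: sumr_ge0 => j _; exact: expR_ge0. Qed.

Lemma softmax_gt0 w : 0 < softmax l w.
Proof. by rewrite -invr_gt0 softmax_invE ltr_pwDl// rival_weight_ge0. Qed.

Lemma softmax_lt1 w : (1 < #|V|)%N -> softmax l w < 1.
Proof.
move=> V2; rewrite -invf_gt1 ?softmax_gt0// softmax_invE ltrDl.
have [j jw] : exists j, j != w.
  have /card_gt1P[x [y [_ _ xy]]] := V2.
  by have [xw|xw] := eqVneq x w; [exists y; rewrite -xw eq_sym|exists x].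
rewrite /rival_weight (bigD1 j)//= ltr_pwDl ?expR_gt0// sumr_ge0//.
Qed.

End softmax.

Section argmax_law.
Context d (T : measurableType d) (R : realType) (P : probability T R)
  (V : finType) (l : V -> R) (xi : V -> {RV P >-> R}).
Hypotheses (gxi : forall i, is_gumbel01 P (xi i))
  (ixi : mutually_independent P (fun i => (xi i : T -> R))).
Variable wstar : T -> V.
Hypotheses (argmax : forall t i, l i + xi i t <= l (wstar t) + xi (wstar t) t)
  (mwstar : forall w, measurable [set t | wstar t = w]).
Variable w : V.

Let A := [set t | wstar t = w].
Let p := softmax l w.
Let p0 : 0 < p. Proof. exact: softmax_gt0. Qed.
Let c := rival_weight l w.
(** The probability that every rival of [w] has a perturbed logit at most [l w + x]. *)
Let g x : R := expR (- (c * expR (- x))).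

Let slab a b := xi w @^-1` `]a, b].
(** A product event: [xi w] in (a, b] and every rival's perturbed logit at most [l w + y]. The
    choices [y = a] and [y = b] enclose the argmax event from inside and from outside. *)
Let box a b y : set T := \bigcap_(i in [set: V])
  (xi i @^-1` (if i == w then `]a, b]%classic else `]-oo, y + l w - l i]%classic)).

Let xi_cdf i x : P (xi i @^-1` `]-oo, x]) = (gumbel_cdf x)%:E.
Proof.
by rewrite -(gxi i x); congr (P _).
Qed.

Let measurable_slab a b : measurable (slab a b).
Proof. by apply: measurable_funPTI. Qed.

Let measurable_box a b y : measurable (box a b y).
Proof.
apply: fin_bigcap_measurable; first exact: finite_finset.
by move=> i _; apply: measurable_funPTI; case: ifP.
Qed.

Let P_slab a b : a <= b -> P (slab a b) = (gumbel_cdf b - gumbel_cdf a)%:E.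
Proof.
move=> ab; rewrite -[slab a b]setTI.
apply: (measure_slab _ _ _ P setT (xi w) gumbel_cdf) => // x.
by rewrite setTI; exact: gxi.
Qed.

Let P_box a b y : a <= b -> P (box a b y) = (g y * (gumbel_cdf b - gumbel_cdf a))%:E.
Proof.
move=> ab; rewrite /box ixi; last by move=> i; case: ifP.
rewrite (bigD1 w)//= eqxx P_slab// EFinM muleC; congr (_ * _)%E.
rewrite (eq_bigr (fun i => (expR (- expR (- (y + l w - l i))))%:E)); last first.
  by move=> i /negbTE ->; exact: xi_cdf.
rewrite prodEFin -expR_sum /g /c /rival_weight mulr_suml -sumrN.
congr (expR _)%:E; apply: eq_bigr => i _; rewrite -expRD.
by congr (- expR _); ring.
Qed.

(** Rivals stay at or below [l w + a] and [w] lies strictly above, so the argmax is [w] whatever the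
    rule for ties. *)
Let box_sub a b : box a b a `<=` A `&` slab a b.
Proof.
move=> t bt; have := bt w I; rewrite /= eqxx /= in_itv/= => /andP[aw wb].
split; last by rewrite /slab/= in_itv/= aw.
apply/eqP; apply: contraT => jw; have := bt (wstar t) I.
rewrite /= (negbTE jw)/= in_itv/= => h.
have := argmax t w; lra.
Qed.

Let sub_box a b : A `&` slab a b `<=` box a b b.
Proof.
move=> t [tw]; rewrite /slab/= in_itv/= => /andP[aw wb] i _ /=.
case: eqP => [->|_]; rewrite /= in_itv/= ?aw//.
have := argmax t i; rewrite tw; lra.
Qed.

Let mA : measurable A. Proof. exact: mwstar. Qed.

Let mAslab a b : measurable (A `&` slab a b).
Proof. exact: measurableI. Qed.

Let continuous_g : continuous g.
Proof.
move=> x; apply: (is_derive_continuous _ _ _ (is_derive_fcomp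
  (fun y => - (c * expR (- y))) (is_derive_expR _)
  (is_derive_fN (is_derive_fM (is_derive_fcst c x) (is_derive_expRN x))))).
Qed.

(** Since c + 1 = 1 / p, the product is exp (- e^(-x) / p). *)
Let gumbel_cdf_shift x : g x * gumbel_cdf x = gumbel_cdf (x + ln p).
Proof.
rewrite /g /gumbel_cdf -expRD; congr expR.
rewrite opprD expRD (expRN (ln p)) lnK// softmax_invE -/c; ring.
Qed.

Let Phi x := p * gumbel_cdf (x + ln p).

Let is_derive_Phi (x : R) : is_derive x 1 Phi (g x * (expR (- x) * gumbel_cdf x)).
Proof.
have d1 := is_derive_fM (is_derive_fcst p x) (is_derive_fcomp (fun y => y + ln p)
  (is_derive_gumbel_cdf (x + ln p)) (is_derive_fD (is_derive_fid x) (is_derive_fcst (ln p) x))).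
apply: (is_derive_eq d1) => /=.
rewrite mulr0 addr0 addr0 mulr1 mulrCA [in RHS]mulrCA -gumbel_cdf_shift.
rewrite opprD expRD (expRN (ln p)) lnK//.
by field; rewrite gt_eqF.
Qed.

(** The probability is additive in the slab and lies between those of the two boxes, so
    [increments_primitive] applies with [g] as integrand. *)
Let P_Aslab a b : a <= b -> P (A `&` slab a b) = (Phi b - Phi a)%:E.
Proof.
move=> ab; have fin a' b' : P (A `&` slab a' b') \is a fin_num by exact: fin_num_measure.
rewrite -(fineK (fin a b)); congr EFin.
apply: (increments_primitive gumbel_cdf (fun x => expR (- x) * gumbel_cdf x) g
  (fun a b => fine (P (A `&` slab a b))) Phi) => //.
- move=> x y xy; rewrite /gumbel_cdf ler_expR lerN2 ler_expR lerN2//.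
- exact: is_derive_gumbel_cdf.
- by move=> x; exact: expR_ge0.
- move=> {ab} a' b' e ab be; rewrite -fineD// -measureU//.
    congr (fine (P _)); apply/seteqP; split=> t; rewrite /slab/= !in_itv/=.
      by move=> [At /andP[h1 h2]]; have [h3|h3] := leP (xi w t) b'; [left|right]; rewrite ?h1 ?h2.
    by move=> [] [At /andP[h1 h2]]; split => //; apply/andP; split; lra.
  apply/seteqP; split=> t //=; rewrite /slab/= !in_itv/=.
  by move=> [[_ /andP[_ h1]] [_ /andP[h2 _]]]; lra.
- move=> {ab} a' b' m M ab m0 mM.
  have F0 : 0 <= gumbel_cdf b' - gumbel_cdf a'.
    by rewrite subr_ge0 /gumbel_cdf ler_expR lerN2 ler_expR lerN2.
  have /andP[ma _] : m <= g a' <= M by apply: mM; rewrite lexx ab.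
  have /andP[_ Mb] : m <= g b' <= M by apply: mM; rewrite lexx ab.
  rewrite -!lee_fin fineK//; apply/andP; split.
    apply: (@le_trans _ _ (P (box a' b' a'))).
      by rewrite P_box// lee_fin ler_wpM2r.
    by apply: le_measure; rewrite ?inE//; exact: box_sub.
  apply: (@le_trans _ _ (P (box a' b' b'))).
    by apply: le_measure; rewrite ?inE//; exact: sub_box.
  by rewrite P_box// lee_fin ler_wpM2r.
Qed.

(** Continuity from below, as the left end of the slab goes to minus infinity; [gumbel_cdf_le] makes
    [Phi] vanish there. *)
Lemma argmax_law x : P (A `&` [set t | xi w t <= x]) = (p * gumbel_cdf (x + ln p))%:E.
Proof.
have -> : A `&` [set t | xi w t <= x] = \bigcup_n (A `&` slab (x - n%:R) x).
  rewrite -setI_bigcupr; congr (_ `&` _); apply/seteqP; split=> t /=.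
    move=> tx; exists (Num.Def.truncn (x - xi w t)).+1 => //=.
    rewrite /slab/= in_itv/= tx andbT; have := truncnS_gt (x - xi w t); lra.
  by move=> [n _]; rewrite /slab/= in_itv/= => /andP[].
have nd : nondecreasing_seq (fun n => A `&` slab (x - n%:R) x).
  move=> m n mn; apply/subsetPset; apply: setIS => t; rewrite /slab/= !in_itv/=.
  move=> /andP[h ->]; rewrite andbT; apply: le_lt_trans h.
  by rewrite lerD2l lerN2 ler_nat.
have cP := nondecreasing_cvg_mu (mu := P) (fun n => mAslab (x - n%:R) x)
  (bigcup_measurable (fun n _ => mAslab (x - n%:R) x)) nd.
have cPhi : Phi (x - n%:R) @[n --> \oo] --> 0.
  rewrite /Phi -[X in _ --> X](mulr0 p); apply: cvgMr.
  have b0 : expR (x + ln p) * expR (- n%:R) @[n --> \oo] --> (0 : R).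
    by rewrite -[X in _ --> X](mulr0 (expR (x + ln p))); apply: cvgMr; exact: cvgn_expR.
  apply: (squeeze_cvgr _ (cvg_cst 0) b0); apply: nearW => n.
  rewrite expR_ge0/= -expRD addrAC.
  exact: gumbel_cdf_le.
apply: (cvg_unique _ cP) => //.
have -> : (P \o (fun n => A `&` slab (x - n%:R) x)) = (fun n => (Phi x - Phi (x - n%:R))%:E).
  by apply/funext => n /=; rewrite P_Aslab// gerBl.
apply: cvg_EFin; first exact: nearW.
by rewrite -[X in _ --> X]subr0; apply: cvgB => //; exact: cvg_cst.
Qed.

End argmax_law.

(** * Variance bound *)

Section variance_bound.
Context {R : realType}.

Lemma expR_ge_taylor3 (x : R) : 0 <= x ->
  1 + x + x ^+ 2 / 2 + x ^+ 3 / 6 <= expR x.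
Proof.
move=> x0.
have nd : nondecreasing_seq (series (exp_coeff x)).
  apply/nondecreasing_seqP => n.
  by rewrite /series/= big_nat_recr//= lerDl divr_ge0// exprn_ge0.
suff -> : 1 + x + x ^+ 2 / 2 + x ^+ 3 / 6 = series (exp_coeff x) 4.
  exact: nondecreasing_cvgn_le nd (is_cvg_series_exp_coeff x) 4%N.
rewrite /series /= big_mkord !big_ord_recr big_ord0 /exp_coeff /= add0r.
rewrite expr0 expr1 (_ : 0`! = 1%N)// (_ : 1`! = 1%N)// (_ : 2`! = 2%N)//.
by rewrite (_ : 3`! = 6%N)// !divr1.
Qed.

Lemma pi2_6_le (p : R) : 0 < p < 1 ->
  pi ^+ 2 / 6 <= 2 * p ^+ 2 / (1 - p) ^+ 3 + 2 / p - (- ln p + euler_gamma R) ^+ 2.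
Proof.
move=> /andP[p0 p1].
have z2 : pi ^+ 2 / 6 <= 5 / 3 :> R.
  apply: (ler_cvg_to (@cvg_inv2_sum R) (cvg_cst _)).
  by apply: nearW => n; exact: inv2_sum_le.
have g0 := @euler_gamma_ge0 R; have g1 := @euler_gamma_le R.
pose m := - ln p.
have m0 : 0 < m by rewrite oppr_gt0 ln_lt0// p0.
have pm : p = expR (- m) by rewrite opprK lnK.
have q0 : 0 < (1 - p) ^+ 3 by rewrite exprn_gt0// subr_gt0.
have t0 : 0 <= 2 * p ^+ 2 / (1 - p) ^+ 3.
  by apply: divr_ge0 (ltW q0); apply: mulr_ge0; rewrite ?sqr_ge0.
have pV : p^-1 = expR m by rewrite pm -expRN opprK.
have := expR_ge_taylor3 _ (ltW m0); rewrite -pV -/m.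
set e := p^-1; move: (euler_gamma R) g0 g1 (pi ^+ 2 / 6) z2 => y g0 g1 z z2 h.
have my : m * y <= m * (5 / 6) by rewrite ler_wpM2l// ltW.
have yy : y ^+ 2 <= 25 / 36.
  by have : y ^+ 2 <= (5 / 6) ^+ 2 by [rewrite lerXn2r ?nnegrE//; lra]; lra.
(* The cubic Taylor bound on 2 e^m cancels m^2, [y <= 5 / 6] leaves m / 3 of the linear terms, and
   the constants give 25/36 + 5/3 - 2 = 13/36. *)
suff key : 13 / 36 <= 2 * p ^+ 2 / (1 - p) ^+ 3 + m / 3 + m ^+ 3 / 3.
  by rewrite sqrrD mulr2n; lra.
have m3 : 0 <= m ^+ 3 by rewrite exprn_ge0// ltW.
(* For m >= 4/5 the terms in m suffice; below that, p is at least 2/5 and the fraction suffices. *)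
have [mlo|mhi] := leP (4 / 5) m.
  have : (4 / 5) ^+ 3 <= m ^+ 3 by rewrite lerXn2r ?nnegrE//; lra.
  lra.
(* Here e^(-m/4) >= 1 - m/4 > 4/5, and (4/5)^4 > 2/5. *)
have p25 : 2 / 5 <= p.
  have -> : p = expR (- m / 4) ^+ 4 by rewrite -expRM_natr pm; congr expR; field.
  apply: (@le_trans _ _ ((1 + - m / 4) ^+ 4)).
    apply: (@le_trans _ _ ((4 / 5) ^+ 4)); first lra.
    by rewrite lerXn2r ?nnegrE//; lra.
  by rewrite lerXn2r// ?nnegrE ?expR_ge0// ?expR_ge1Dx//; lra.
have q3 : (1 - p) ^+ 3 <= (3 / 5) ^+ 3 by rewrite lerXn2r ?nnegrE//; lra.
have p2 : (2 / 5) ^+ 2 <= p ^+ 2 by rewrite lerXn2r ?nnegrE//; lra.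
suff : 13 / 36 <= 2 * p ^+ 2 / (1 - p) ^+ 3 by lra.
by rewrite ler_pdivlMr//; lra.
Qed.

End variance_bound.

(** * Integrals split along the value of a random token *)

Section partition.
Context d (T : measurableType d) (R : realType) (P : probability T R)
  (V : finType) (W : T -> V).
Hypothesis mW : forall j, measurable [set t | W t = j].

Let fibers : \big[setU/set0]_(j <- index_enum V) [set t | W t = j] = setT.
Proof.
rewrite -bigcup_seq; apply/seteqP; split=> t //= _.
by exists (W t) => //=; rewrite mem_index_enum.
Qed.

Lemma integral_fibers (f : T -> R) : measurable_fun setT f ->
  (\int[P]_t (f t)%:E = \sum_(j : V) \int[P]_(t in [set t | W t = j]) (f t)%:E)%E.
Proof.
move=> mf; rewrite -{1}fibers integral_bigsetU_EFin//.
- exact: index_enum_uniq.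
- by move=> i j _ _ [t [/= -> ->]].
- by rewrite fibers; exact/measurable_EFinP.
Qed.

Lemma sum_fibers : \sum_(j : V) fine (P [set t | W t = j]) = 1.
Proof.
have e1 D : measurable D -> (\int[P]_(t in D) (cst (1 : R) t)%:E = P D)%E.
  by move=> mD; rewrite (integral_cst P mD 1%E) mul1e.
apply: EFin_inj; rewrite -sumEFin -(@probability_setT _ _ _ P) -e1//.
rewrite integral_fibers; last exact: measurable_cst.
by apply: eq_bigr => j _; rewrite e1// fineK// fin_num_measure.
Qed.

Lemma integral_fibers_cst (f : T -> R) (c : R) : measurable_fun setT f ->
  (forall j, (\int[P]_(t in [set t | W t = j]) (f t)%:E =
    (fine (P [set t | W t = j]) * c)%:E)%E) ->
  (\int[P]_t (f t)%:E = c%:E)%E.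
Proof.
move=> mf fc; rewrite integral_fibers// (eq_bigr _ (fun j _ => fc j)) sumEFin.
by rewrite -mulr_suml sum_fibers mul1r.
Qed.

Lemma measurable_fun_fibers (f : V -> T -> R) :
  (forall j, measurable_fun setT (f j)) -> measurable_fun setT (fun t => f (W t) t).
Proof.
move=> mf _ B mB; rewrite setTI.
rewrite (_ : _ @^-1` _ = \bigcup_(j in [set: V]) ([set t | W t = j] `&` f j @^-1` B)).
  apply: fin_bigcup_measurable; first exact: finite_finset.
  by move=> j _; apply: measurableI => //; rewrite -[_ @^-1` _]setTI; exact: mf.
by apply/seteqP; split=> [t /= Bt|t [j _ [/= -> //]]]; exists (W t).
Qed.

End partition.

(** * Moments of the score with and without the watermark *)

Theorem theorem1 (d : measure_display) (T : measurableType d) (R : realType)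
  (P : probability T R) (V : finType) (l : V -> R) (xi : V -> {RV P >-> R}) :
  (1 < #|V|)%N ->
  (forall i, is_gumbel01 P (xi i)) ->
  mutually_independent P (fun i => (xi i : T -> R)) ->
  (* (1) watermarked token: wstar t is an argmax of l i + xi i t *)
  (forall wstar : T -> V,
     (forall t i, l i + xi i t <= l (wstar t) + xi (wstar t) t) ->
     (forall w, measurable [set t | wstar t = w]) ->
     forall w : V,
       let A := [set t | wstar t = w] in
       let p := softmax l w in
       cond_expectation P A (xi w) = (- ln p + euler_gamma R)%:E /\
       (cond_variance P A (xi w) <=
          (2 * p ^+ 2 / (1 - p) ^+ 3 + 2 / p - (- ln p + euler_gamma R) ^+ 2)%:E)%E)
  /\
  (* (2) unwatermarked token: w chosen independently of xi *)
  (forall w : T -> V,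
     (forall j, measurable [set t | w t = j]) ->
     token_independent P w (fun i => (xi i : T -> R)) ->
     ('E_P[fun t => xi (w t) t] = (euler_gamma R)%:E)%E /\
     ('V_P[fun t => xi (w t) t] = (pi ^+ 2 / 6 : R)%:E)%E).
Proof.
move=> V2 gxi ixi; split.
- move=> wstar argmax mwstar w A p.
  have p0 : 0 < p := softmax_gt0 l w.
  have mA : measurable A := mwstar w.
  (* By [argmax_law], this shifted score has on [A] a Gumbel law of mass [p]. *)
  pose X t := xi w t + ln p.
  have mX : measurable_fun setT X by apply: measurable_funD.
  have XA x : P (A `&` [set t | X t <= x]) = (p * gumbel_cdf x)%:E.
    rewrite -[x in RHS](subrK (ln p)) -(argmax_law _ _ _ _ _ _ _ gxi ixi _ argmax mwstar).
    by congr (P (_ `&` _)); apply/seteqP; split=> t; rewrite /= lerBrDr.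
  have PA := gumbel_mass _ _ _ _ _ _ _ mA mX XA.
  have [_ h1] : has_integral P A (xi w) (p * euler_gamma R + - ln p * p).
    apply: has_integral_ext (has_integralD mA (gumbel_moment1 _ _ _ _ _ _ _ mA mX XA)
      (has_integral_cst mA (- ln p) PA)) => t.
    by rewrite /X addrK.
  have mean : cond_expectation P A (xi w) = (- ln p + euler_gamma R)%:E.
    rewrite /cond_expectation h1 PA -EFinM; congr EFin.
    by rewrite /=; field; rewrite gt_eqF.
  split => //.
  have [_ h2] := gumbel_centered_moment _ _ _ _ _ _ _ mA mX XA (euler_gamma R).
  rewrite /cond_variance mean /cond_expectation.
  (* Centring the score at its conditional mean is centring [X] at the Euler constant. *)
  rewrite (eq_integral (fun t => ((X t - euler_gamma R) ^+ 2)%:E)); last first.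
    by move=> t _; rewrite /X /=; congr (_ ^+ 2)%:E; ring.
  rewrite h2 PA -EFinM lee_fin /= subrr expr0n addr0 mulrC mulKf ?gt_eqF//.
  (* What remains is pi^2 / 6 against the stated bound; having two tokens gives [p < 1]. *)
  by apply: pi2_6_le; rewrite p0 softmax_lt1.
- move=> W mW indep.
  (* Independence of the token from the key leaves [xi j] Gumbel on the fibre of [j], with the mass
     of that fibre. *)
  have Xj j x : P ([set t | W t = j] `&` [set t | xi j t <= x]) =
      (fine (P [set t | W t = j]) * gumbel_cdf x)%:E.
    pose B i : set R := if i == j then `]-oo, x]%classic else setT.
    have mB i : measurable (B i) by rewrite /B; case: ifP.
    have -> : [set t | xi j t <= x] = \bigcap_(i in [set: V]) (xi i @^-1` B i).
      apply/seteqP; split=> t /=.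
        by move=> tx i _; rewrite /B /=; case: eqP => [->|]//; rewrite /= in_itv.
      by move=> /(_ j I); rewrite /B /= eqxx/= in_itv.
    rewrite indep// [X in (_ * X)%E](_ : _ = (gumbel_cdf x)%:E).
      by rewrite EFinM fineK// fin_num_measure.
    rewrite -(gxi j x); congr (P _); apply/seteqP; split=> t /=.
      by move=> /(_ j I); rewrite /B /= eqxx/= in_itv.
    by move=> tx i _; rewrite /B /=; case: eqP => [->|]//; rewrite /= in_itv.
  have mf := measurable_fun_fibers _ _ _ _ _ mW (fun j => xi j : T -> R)
    (fun j => measurable_funPT (xi j)).
  have mean : ('E_P[fun t => xi (W t) t] = (euler_gamma R)%:E)%E.
    rewrite expectation.unlock; apply: (integral_fibers_cst _ _ _ _ _ _ mW) => // j.
    have [_ <-] := gumbel_moment1 _ _ _ _ _ _ _ (mW j) (measurable_funPT (xi j)) (Xj j).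
    by apply: eq_integral => t; rewrite inE /= => ->.
  split => //.
  rewrite /variance covariance.unlock mean expectation.unlock.
  apply: (integral_fibers_cst _ _ _ _ _ _ mW).
    by apply: measurable_funM; apply: measurable_funB.
  move=> j.
  have [_] := gumbel_centered_moment _ _ _ _ _ _ _ (mW j) (measurable_funPT (xi j)) (Xj j) (euler_gamma R).
  rewrite subrr expr0n addr0 => <-.
  by apply: eq_integral => t; rewrite inE => /= <-; rewrite expr2.
Qed.
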